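(* Let $Y,Y_1,Y_2,\ldots$ be iid non-degenerate random variables, let $1\le m_1\le\cdots\le m_p$ be integers, and let $X_j=\sum_{i=1}^{m_j}Y_i$ for $j=1,\ldots,p$. Let $R=(R_{j,k})_{p\times p}$ be the matrix with elements $R_{j,k}=(m_j\wedge m_k)/\sqrt{m_jm_k}$. Then, for every weight matrix $W=(W_{j,k})_{p\times p}$ with $W_{j,k}=W_{k,j}\ge0$ and with $\nu$ the counting measure on $\{1,\ldots,p\}$, $$\rho^{NL}_{\max}(X_{1:p};\nu,W)=\lambda_{\max}(R\circ W),\qquad \rho^{NL}_{\min}(X_{1:p};\nu,W)=\lambda_{\min}(R\circ W).$$ If in addition $Y$ has a finite second moment, then $R$ is the correlation matrix of $(X_1,\ldots,X_p)$, and for all measures $\nu$ on $\{1,\ldots,p\}$ and all weights $W_{j,k}=W_{k,j}\ge0$, $$\rho^{NL}_{\max}(X_{1:p};\nu,W)=\rho^{L}_{\max}(X_{1:p};\nu,W),\qquad \rho^{NL}_{\min}(X_{1:p};\nu,W)=\rho^{L}_{\min}(X_{1:p};\nu,W).$$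
   Context: A random variable is non-degenerate if its distribution is not concentrated at a single point. $\circ$ is the Schur (entrywise) product; $\lambda_{\max},\lambda_{\min}$ are the largest and smallest eigenvalues of a symmetric matrix; $a\wedge b=\min(a,b)$; $\rho(U,V)$ is the Pearson correlation. For random variables $X_{1:p}=(X_1,\ldots,X_p)$, a finite nonzero measure $\nu$ on $\{1,\ldots,p\}$ and symmetric weights $W_{j,k}\ge0$, $$\rho^{NL}_{\max}(X_{1:p};\nu,W)=\sup_{f_1,\ldots,f_p}\ \sup_{h}\sum_{j=1}^p\sum_{k=1}^p\rho\big(f_j(X_j),f_k(X_k)\big)W_{j,k}h(j)h(k)\,\nu(\{j\})\nu(\{k\}),$$ where the first supremum is over deterministic functions $f_j$ with $\mathbb E[f_j(X_j)]=0$ and $0<\mathbb E[f_j^2(X_j)]<\infty$, and the second over $h:\{1,\ldots,p\}\to\mathbb R$ with $\sum_jh^2(j)\nu(\{j\})=1$. $\rho^{NL}_{\min}(X_{1:p};\nu,W)$ is the same with both suprema replaced by infima. The linear versions $\rho^{L}_{\max}(X_{1:p};\nu,W)$, $\rho^{L}_{\min}(X_{1:p};\nu,W)$ are obtained by replacing $\rho(f_j(X_j),f_k(X_k))$ by $\rho(X_j,X_k)$ and taking only the supremum, respectively infimum, over $h$. For the counting measure $\nu$, $\rho^{NL}_{\max}$ (resp. $\rho^{NL}_{\min}$) is the supremum (resp. infimum) over $f_1,\ldots,f_p$ of the largest (resp. smallest) eigenvalue of the matrix $(\rho(f_j(X_j),f_k(X_k))W_{j,k})_{p\times p}$. *)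

(* Defs.v *)
From HB Require Import structures.
From mathcomp Require Import all_boot all_order all_algebra.
From mathcomp Require Import all_classical all_reals all_analysis.

Set Implicit Arguments.
Unset Strict Implicit.
Unset Printing Implicit Defensive.

Import Order.TTheory GRing.Theory Num.Theory.

Local Open Scope classical_set_scope.
Local Open Scope ring_scope.

(* Discrete sigma-algebra on a nonempty finite index set (measurable types of
   the library are pointed, hence the successor). *)
HB.instance Definition _ (n : nat) := isPointed.Build 'I_n.+1 ord0.
HB.instance Definition _ (n : nat) :=
  @isMeasurable.Build default_measure_display 'I_n.+1
    discrete_measurable discrete_measurable0
    discrete_measurableC discrete_measurableU.

Definition mutually_independent d (T : measurableType d) (R : realType)
    (P : probability T R) (I : choiceType) (Y : I -> {RV P >-> R}) : Prop :=
  forall (s : seq I) (A : I -> set R), uniq s ->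
    (forall i, measurable (A i)) ->
    (P (\bigcap_(i in [set` s]) (Y i @^-1` A i)) =
     \prod_(i <- s) P (Y i @^-1` A i))%E.

(* Only measurable sets are compared: the value of a library measure on a
   non-measurable set is unconstrained. *)
Definition identically_distributed d (T : measurableType d) (R : realType)
    (P : probability T R) (I : Type) (Y : I -> {RV P >-> R}) : Prop :=
  forall (i j : I) (A : set R), measurable A ->
    distribution P (Y i) A = distribution P (Y j) A.

Definition iid d (T : measurableType d) (R : realType)
    (P : probability T R) (I : choiceType) (Y : I -> {RV P >-> R}) : Prop :=
  mutually_independent Y /\ identically_distributed Y.

Definition non_degenerate d (T : measurableType d) (R : realType)
    (P : probability T R) (X : {RV P >-> R}) : Prop :=
  forall c : R, distribution P X [set c] <> 1%E.

Definition correlation d (T : measurableType d) (R : realType)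
    (P : probability T R) (U V : T -> R) : R :=
  fine (covariance P U V) /
  (Num.sqrt (fine ('V_P[U])%E) * Num.sqrt (fine ('V_P[V])%E)).

Definition correlation_mx d (T : measurableType d) (R : realType)
    (P : probability T R) (p : nat) (X : 'I_p -> T -> R) : 'M[R]_p :=
  \matrix_(j, k) correlation P (X j) (X k).

Section weighted_forms.
Variables (R : realType) (p : nat).
Implicit Types (nu : set 'I_p -> \bar R) (W C : 'M[R]_p) (h : 'I_p -> R).

Definition weighted_form nu W C h : R :=
  \sum_(j < p) \sum_(k < p)
    C j k * W j k * h j * h k * fine (nu [set j]) * fine (nu [set k]).

Definition unit_norm nu : set ('I_p -> R) :=
  [set h | \sum_(j < p) h j ^+ 2 * fine (nu [set j]) = 1].

Definition form_max nu W C : \bar R :=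
  ereal_sup [set (weighted_form nu W C h)%:E | h in unit_norm nu].

Definition form_min nu W C : \bar R :=
  ereal_inf [set (weighted_form nu W C h)%:E | h in unit_norm nu].

End weighted_forms.

Section maximal_correlation.
Context d (T : measurableType d) (R : realType) (P : probability T R).
Variables (p : nat) (X : 'I_p -> T -> R).
Implicit Types (nu : set 'I_p -> \bar R) (W : 'M[R]_p).

Definition transform (f : 'I_p -> {mfun R >-> R}) : 'I_p -> T -> R :=
  fun j => f j \o X j.

(* A finite second moment makes transform f j integrable, so that the first
   expectation below is a genuine one. *)
Definition admissible : set ('I_p -> {mfun R >-> R}) :=
  [set f | forall j, [/\ 'E_P[transform f j] = 0,
                         0 < 'E_P[transform f j ^+ 2] &
                         'E_P[transform f j ^+ 2] < +oo]%E].

Definition rhoNL_max nu W : \bar R :=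
  ereal_sup [set form_max nu W (correlation_mx P (transform f)) | f in admissible].

Definition rhoNL_min nu W : \bar R :=
  ereal_inf [set form_min nu W (correlation_mx P (transform f)) | f in admissible].

Definition rhoL_max nu W : \bar R := form_max nu W (correlation_mx P X).

Definition rhoL_min nu W : \bar R := form_min nu W (correlation_mx P X).

End maximal_correlation.

Definition schur_prod (R : realType) (p : nat) (A B : 'M[R]_p) : 'M[R]_p :=
  map2_mx *%R A B.

(* Used for symmetric real matrices of positive size, whose set of eigenvalues
   is finite and nonempty: the supremum and infimum are then attained. *)
Definition lambda_max (R : realType) (p : nat) (A : 'M[R]_p) : R :=
  sup [set a | eigenvalue A a].

Definition lambda_min (R : realType) (p : nat) (A : 'M[R]_p) : R :=
  inf [set a | eigenvalue A a].

(* Partial sums start at index 1: Y 0 plays the role of the generic copy. *)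
Definition partial_sum (T : Type) (R : realType) (Y : nat -> T -> R) (n : nat) :
    T -> R :=
  fun t => \sum_(1 <= i < n.+1) Y i t.

Definition overlap_mx (R : realType) (p : nat) (m : 'I_p -> nat) : 'M[R]_p :=
  \matrix_(j, k) ((minn (m j) (m k))%:R / Num.sqrt ((m j)%:R * (m k)%:R)).

(* Main.v *)
(* Put G(j,k) = Cov(f_j(X_j), f_k(X_k)) / min(m_j, m_k). The key point is that G
   is positive semidefinite, so that every admissible correlation matrix is the
   Schur product of R with a positive semidefinite matrix of unit diagonal, and
   by the Schur product theorem the weighted quadratic form of such a product
   stays within the bounds of the form of R.

   With K f(x) = E f(x + Y) and S_l the sum over m_j >= l of K^(m_j - l) f_j,
   which satisfies S_l(X_l) = E[sum_(m_j >= l) f_j(X_j) | Y_1, ..., Y_l], the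
   quadratic form of G is the sum over l of
     (E S_l(X_l)^2 - E (K S_(l+1))(X_l)^2) / l,
   which telescopes to something nonnegative thanks to the inequality of
   Dembo, Kagan and Shepp: (l+1) E (K f)(X_l)^2 <= l E f(X_(l+1))^2 for centred
   f(X_(l+1)). The latter follows from the convexity in l of
   E (K^(n-l) f)(X_l)^2. All this is done for bounded f, where K is everywhere
   defined, and extended to square integrable f by truncation.

   Conversely R is a limit of admissible correlation matrices: take f_j linear
   if Y has a finite second moment; otherwise truncate the X_j at level M, since
   then the truncation of X_j differs from the sum of the truncations of the Y_i
   by o(E min(|Y|, M)^2) in mean square as M tends to infinity. *)

From HB Require Import structures.
Require Import Defs.
From mathcomp Require Import all_boot all_order all_algebra.
From mathcomp Require Import all_classical all_reals all_analysis.
From mathcomp Require Import measurable_realfun ring lra.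

Set Implicit Arguments.
Unset Strict Implicit.
Unset Printing Implicit Defensive.

Import Order.TTheory GRing.Theory Num.Theory.
Import numFieldNormedType.Exports.
Local Open Scope classical_set_scope.
Local Open Scope ring_scope.

(** * Schur product theorem *)

Definition qform (R : pzRingType) n (A : 'I_n -> 'I_n -> R) (x : 'I_n -> R) : R :=
  \sum_(i < n) \sum_(j < n) A i j * x i * x j.

(** Symmetry is not part of this notion; it is assumed separately where it matters. *)
Definition psd (R : realFieldType) n (A : 'I_n -> 'I_n -> R) : Prop :=
  forall x, 0 <= qform A x.

Section schur_product.
Variable R : realFieldType.

Lemma dsum_recl n (F : 'I_n.+1 -> 'I_n.+1 -> R) :
  \sum_i \sum_j F i j =
    F ord0 ord0 + \sum_(j < n) (F ord0 (lift ord0 j) + F (lift ord0 j) ord0) +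
    \sum_(i < n) \sum_(j < n) F (lift ord0 i) (lift ord0 j).
Proof.
rewrite big_ord_recl big_ord_recl big_split /= -!addrA; congr (_ + (_ + _)).
rewrite -big_split; apply: eq_bigr => i _; exact: big_ord_recl.
Qed.

Definition fcons n (t : R) (x : 'I_n -> R) (i : 'I_n.+1) : R :=
  if unlift ord0 i is Some k then x k else t.

Lemma fcons0 n t (x : 'I_n -> R) : fcons t x ord0 = t.
Proof. by rewrite /fcons unlift_none. Qed.

Lemma fconsS n t (x : 'I_n -> R) i : fcons t x (lift ord0 i) = x i.
Proof. by rewrite /fcons liftK. Qed.

Lemma qform_fcons n (A : 'I_n.+1 -> 'I_n.+1 -> R) t (x : 'I_n -> R) :
  (forall i j, A i j = A j i) ->
  qform A (fcons t x) = A ord0 ord0 * t ^+ 2 +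
    2 * t * (\sum_(j < n) A ord0 (lift ord0 j) * x j) +
    qform (fun i j => A (lift ord0 i) (lift ord0 j)) x.
Proof.
move=> sA; rewrite /qform dsum_recl mulr_sumr; congr (_ + _ + _).
- by rewrite fcons0; ring.
- by apply: eq_bigr => j _; rewrite (sA (lift _ _) ord0) fcons0 fconsS; ring.
- by under eq_bigr do under eq_bigr do rewrite !fconsS.
Qed.

Lemma psd_diag_ge0 n (A : 'I_n -> 'I_n -> R) (k : 'I_n) :
  psd A -> 0 <= A k k.
Proof.
move=> /(_ (fun i => (i == k)%:R)).
rewrite /qform (bigD1 k)//= (bigD1 k)//= eqxx !mulr1.
rewrite big1 => [|i /negPf ik]; last by rewrite ik mulr0.
rewrite big1 => [|i /negPf ik]; first by rewrite !addr0.
by apply: big1 => j _; rewrite ik mulr0 mul0r.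
Qed.

Lemma psd_lift n (A : 'I_n.+1 -> 'I_n.+1 -> R) :
  psd A -> psd (fun i j => A (lift ord0 i) (lift ord0 j)).
Proof.
move=> pA x; have := pA (fcons 0 x); rewrite /qform dsum_recl.
rewrite fcons0 mulr0 add0r big1 ?add0r => [|i _].
  by under eq_bigr do under eq_bigr do rewrite !fconsS.
by rewrite !(mulr0, mul0r) addr0.
Qed.

(** With a zero corner the form is affine in the first coordinate, so a nonzero entry of the first
    row would make it unbounded below. *)
Lemma psd_row_eq0 n (A : 'I_n.+1 -> 'I_n.+1 -> R) (j : 'I_n) :
  (forall i j, A i j = A j i) -> psd A -> A ord0 ord0 = 0 ->
  A ord0 (lift ord0 j) = 0.
Proof.
move=> sA pA A0; apply/eqP/contraT => Aj.
pose b := A ord0 (lift ord0 j); pose c := A (lift ord0 j) (lift ord0 j).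
(* Solves [2 * t * b + c = -1], where the left side is the value of the form at [fcons t x]. *)
pose t := - (c + 1) / (2 * b); pose x (k : 'I_n) : R := (k == j)%:R.
have xj i : i != j -> x i = 0 by rewrite /x => /negPf ->.
have := pA (fcons t x); rewrite qform_fcons// A0 mul0r add0r.
rewrite (bigD1 j)//= {1}/x eqxx mulr1 big1 ?addr0 => [|i /xj ->]; last first.
  by rewrite mulr0.
rewrite /qform (bigD1 j)//= (bigD1 j)//= {1 2}/x eqxx !mulr1.
rewrite big1 ?addr0 => [|i /xj ->]; last by rewrite mulr0.
rewrite big1 ?addr0 => [|i /xj xi]; last first.
  by apply: big1 => k _; rewrite xi mulr0 mul0r.
rewrite -/b -/c (_ : 2 * t * b + c = -1); first by rewrite oppr_ge0 ler10.
by rewrite /t; field; rewrite Aj.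
Qed.

(* The sum splits into a rank-one part, where [psd B] applies directly, and the
   Schur complement of the first entry of [A], which is smaller. *)
Lemma schur_sum_ge0 n (A B : 'I_n -> 'I_n -> R) :
  (forall i j, A i j = A j i) -> psd A -> psd B ->
  0 <= \sum_i \sum_j A i j * B i j.
Proof.
elim: n A B => [|n IHn] A B sA pA pB; first by rewrite big_ord0.
have pB' := psd_lift pB.
set a := A ord0 ord0; have a0 : 0 <= a := psd_diag_ge0 ord0 pA.
have [a_eq0|a_neq0] := eqVneq a 0.
  rewrite dsum_recl -/a a_eq0 mul0r add0r big1 ?add0r; last first.
    by move=> j _; rewrite (sA _ ord0) psd_row_eq0// !mul0r addr0.
  exact: (IHn _ _ _ (psd_lift pA) pB').
pose A' i j := A (lift ord0 i) (lift ord0 j) -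
               A ord0 (lift ord0 i) * A ord0 (lift ord0 j) / a.
have -> : \sum_i \sum_j A i j * B i j =
    a^-1 * qform B (A ord0) +
    \sum_(i < n) \sum_(j < n) A' i j * B (lift ord0 i) (lift ord0 j).
  rewrite /qform !dsum_recl -/a !mulrDr mulr_sumr -!addrA; congr (_ + (_ + _)).
  - by field.
  - by apply: eq_bigr => j _; rewrite (sA (lift _ _) ord0); field.
  - rewrite mulr_sumr -big_split; apply: eq_bigr => i _ /=.
    rewrite mulr_sumr -big_split; apply: eq_bigr => j _ /=.
    by rewrite /A'; field.
apply: addr_ge0; first by rewrite mulr_ge0 ?invr_ge0.
apply: (IHn A' _ _ _ pB') => [i j|x]; first by rewrite /A' sA; ring.
pose s := \sum_(j < n) A ord0 (lift ord0 j) * x j.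
(* This first coordinate minimises the form of [A]; the minimum is the form of the Schur complement
   [A']. *)
have := pA (fcons (- s / a) x); rewrite qform_fcons// -/a -/s.
have -> : qform (fun i j => A (lift ord0 i) (lift ord0 j)) x =
  qform A' x + s ^+ 2 / a.
  rewrite expr2 {1}/s !mulr_suml /qform -big_split; apply: eq_bigr => i _ /=.
  rewrite /s mulr_sumr mulr_suml -big_split; apply: eq_bigr => j _ /=.
  by rewrite /A'; field.
by congr (_ <= _); field.
Qed.

End schur_product.

(** * Extreme eigenvalues of symmetric matrices *)

Section rayleigh.
Variable R : realType.

Lemma qform_le_norm n (A : 'I_n -> 'I_n -> R) x :
  qform A x <= (\sum_i \sum_j `|A i j|) * \sum_i x i ^+ 2.
Proof.
rewrite /qform mulr_suml; apply: ler_sum => i _.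
rewrite mulr_suml; apply: ler_sum => j _; rewrite -mulrA.
apply: (le_trans (ler_norm _)); rewrite normrM ler_wpM2l// ler_norml.
have le1 (k : 'I_n) : x k ^+ 2 <= \sum_i x i ^+ 2.
  by rewrite (bigD1 k)//= lerDl sumr_ge0// => *; exact: sqr_ge0.
have := le1 i; have := le1 j; have := sqr_ge0 (x i + x j).
have := sqr_ge0 (x i - x j); rewrite !expr2 => *; apply/andP; split; lra.
Qed.

Lemma sum_sqr_eq0 n (x : 'I_n -> R) : \sum_i x i ^+ 2 = 0 -> forall i, x i = 0.
Proof.
move=> /eqP; rewrite psumr_eq0 => [/allP x0 i|i _]; last exact: sqr_ge0.
by have := x0 i (mem_index_enum _); rewrite sqrf_eq0 => /eqP.
Qed.

Lemma qformZ n (A : 'I_n -> 'I_n -> R) (t : R) x :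
  qform A (fun i => t * x i) = t ^+ 2 * qform A x.
Proof.
rewrite /qform mulr_sumr; apply: eq_bigr => i _; rewrite mulr_sumr.
by apply: eq_bigr => j _; ring.
Qed.

Lemma qform_mxE n (A : 'M[R]_n) (x : 'rV[R]_n) :
  qform A (x 0) = (x *m A *m x^T) 0 0.
Proof.
rewrite mxE /qform exchange_big /=; apply: eq_bigr => j _.
by rewrite mxE [x^T _ _]mxE mulr_suml; apply: eq_bigr => i _; ring.
Qed.

(** Let z be the image of v under the inverse of [B]. Positivity of the form of [B] at v - z/K
    bounds the form at v from below by 2|v|^2/K minus the form of the inverse divided by K^2, and
    the latter quotient is at most |v|^2/K. *)
Lemma psd_unitmx_coercive n (B : 'M[R]_n) :
  B^T = B -> psd B -> B \in unitmx ->
  exists2 c : R, 0 < c & forall x, c * \sum_i x i ^+ 2 <= qform B x.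
Proof.
(* By [qform_le_norm] the form of the inverse is at most [K] times the squared norm; the added 1
   keeps [K] positive in dimension zero. *)
move=> sB pB uB; pose K := \sum_i \sum_j `|invmx B i j| + 1.
have K0 : 0 < K.
  by rewrite /K ltr_wpDl// sumr_ge0// => i _; exact: sumr_ge0.
exists K^-1 => [|x]; first by rewrite invr_gt0.
pose v : 'rV[R]_n := \row_i x i; pose z := v *m invmx B.
have vE : v 0 = x by apply/funext => i; rewrite mxE.
have zB : z *m B = v by rewrite mulmxKV.
have Bz : B *m z^T = v^T by rewrite -[in LHS]sB -trmx_mul zB.
have := pB ((v - K^-1 *: z) 0); rewrite qform_mxE.
have -> : (v - K^-1 *: z) *m B *m (v - K^-1 *: z)^T =
    v *m B *m v^T - (2 / K) *: (v *m v^T) + K ^- 2 *: (v *m invmx B *m v^T).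
  rewrite [in RHS](_ : v *m invmx B *m v^T = z *m v^T)//.
  have -> : (v - K^-1 *: z)^T = v^T - K^-1 *: z^T.
    by apply/matrixP => i j; rewrite !mxE.
  rewrite mulmxBl -scalemxAl zB !mulmxBr !mulmxBl.
  rewrite -!scalemxAl -!scalemxAr -[v *m B *m z^T]mulmxA Bz.
  have -> : v *m z^T = z *m v^T.
    by rewrite trmx_mul trmx_inv sB mulmxA.
  apply/matrixP => i j; rewrite !mxE; field.
  exact: lt0r_neq0.
have mxE3 (a b c : 'M[R]_1) k l :
  (a - k *: b + l *: c) 0 0 = a 0 0 - k * b 0 0 + l * c 0 0 by rewrite !mxE.
rewrite mxE3 -!qform_mxE.
have vv : (v *m v^T) 0 0 = \sum_i x i ^+ 2.
  by rewrite mxE; apply: eq_bigr => i _; rewrite !mxE expr2.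
rewrite -vv vE.
have : qform (invmx B) x <= K * \sum_i x i ^+ 2.
  apply: (le_trans (qform_le_norm _ _)); rewrite ler_wpM2r//.
    by rewrite sumr_ge0// => *; exact: sqr_ge0.
  by rewrite lerDl.
rewrite -vv; set s := (v *m v^T) 0 0 => h1 h2.
have h3 : K ^- 2 * qform (invmx B) x <= K^-1 * s.
  have -> : K^-1 * s = K ^- 2 * (K * s) by field; exact: lt0r_neq0.
  by rewrite ler_wpM2l// invr_ge0 sqr_ge0.
have h4 : 2 / K * s = 2 * (K^-1 * s) by rewrite mulrA.
lra.
Qed.

(** Let [M] be the supremum of the form on the unit sphere. Then [M%:M - A] is positive
    semidefinite, and if it were invertible, coercivity would lower the supremum. So [M] is an
    eigenvalue, attained at a normalised eigenvector; every other eigenvalue is also a value of the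
    form on the sphere, hence at most [M]. *)
Lemma lambda_maxP n (A : 'M[R]_n.+1) : A^T = A ->
  (forall x, qform A x <= lambda_max A * \sum_i x i ^+ 2) /\
  (exists2 x, \sum_i x i ^+ 2 = 1 & qform A x = lambda_max A).
Proof.
move=> sA.
pose S := [set qform A x | x in [set x | \sum_i x i ^+ 2 = 1]].
have S_ub : ubound S (\sum_i \sum_j `|A i j|).
  by move=> _ [x /= x1 <-]; rewrite (le_trans (qform_le_norm _ _))// x1 mulr1.
have S_sup : has_sup S.
  split; last by exists (\sum_i \sum_j `|A i j|).
  exists (qform A (fun i => (i == ord0)%:R)); exists (fun i => (i == ord0)%:R) => //=.
  rewrite (bigD1 ord0)//= expr1n big1 ?addr0// => i /negPf ->.
  by rewrite expr0n.
pose M := sup S.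
have normalize x : \sum_i x i ^+ 2 != 0 ->
    S ((\sum_i x i ^+ 2)^-1 * qform A x).
  set s := \sum_i _ => s0.
  have s_gt0 : 0 < s.
    by rewrite lt_neqAle eq_sym s0 sumr_ge0// => *; exact: sqr_ge0.
  exists (fun i => (Num.sqrt s)^-1 * x i) => /=; last first.
    by rewrite qformZ exprVn sqr_sqrtr// ltW.
  under eq_bigr do rewrite exprMn.
  by rewrite -mulr_sumr -/s exprVn sqr_sqrtr ?mulVf// ltW.
have qle x c : (forall a, S a -> a <= c) -> qform A x <= c * \sum_i x i ^+ 2.
  move=> Sc; have [x0|x0] := eqVneq (\sum_i x i ^+ 2) 0.
    rewrite x0 mulr0 /qform big1// => i _; apply: big1 => j _.
    by rewrite (sum_sqr_eq0 x0 i) mulr0 mul0r.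
  have s_gt0 : 0 < \sum_i x i ^+ 2.
    by rewrite lt_neqAle eq_sym x0 sumr_ge0// => *; exact: sqr_ge0.
  by have := Sc _ (normalize x x0); rewrite ler_pdivrMl// mulrC.
have qM x : qform A x <= M * \sum_i x i ^+ 2.
  by apply: qle => a Sa; exact: (ub_le_sup S_sup.2 Sa).
pose B := M%:M - A.
have qB x : qform B x = M * \sum_i x i ^+ 2 - qform A x.
  rewrite /qform mulr_sumr -sumrB; apply: eq_bigr => i _.
  transitivity (\sum_j (M *+ (i == j) * x i * x j - A i j * x i * x j)).
    by apply: eq_bigr => j _; rewrite !mxE; ring.
  rewrite sumrB; congr (_ - _); rewrite (bigD1 i)//= eqxx big1 => [|j /negPf ji].
    by rewrite mulr1n; ring.
  by rewrite eq_sym ji mulr0n !mul0r.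
have eigenvalue_le a : eigenvalue A a -> S a.
  move=> /eigenvalueP[v vA v0].
  have s0 : \sum_i v 0 i ^+ 2 != 0.
    apply: contra_neq v0 => s0; apply/rowP => i.
    by rewrite (sum_sqr_eq0 s0 i) mxE.
  have := normalize _ s0; congr S.
  rewrite qform_mxE vA -scalemxAl mxE mulrCA [X in _ * X](_ : _ = 1) ?mulr1//.
  rewrite mxE [X in _ * X](_ : _ = \sum_i v 0 i ^+ 2) ?mulVf//.
  by apply: eq_bigr => i _; rewrite mxE expr2.
have eigM : eigenvalue A M.
  apply: contraT => nM.
  have uB : B \in unitmx.
    move: nM; rewrite /eigenvalue /eigenspace kermx_eq0 negbK row_free_unit.
    by rewrite -(@unitmxZ _ _ (-1)) ?unitrN1 // scaleN1r opprB.
  have sB : B^T = B by rewrite linearB /= tr_scalar_mx sA.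
  have pB : psd B by move=> x; rewrite qB subr_ge0.
  have [c c0 hc] := psd_unitmx_coercive sB pB uB.
  (* Coercivity of [B] makes [M - c] an upper bound of [S]. *)
  have : M <= M - c.
    apply: ge_sup; first exact: S_sup.1.
    by move=> _ [x /= x1 <-]; have := hc x; rewrite qB x1; lra.
  by rewrite lerDl oppr_ge0 leNgt c0.
have -> : lambda_max A = M.
  apply/eqP; rewrite eq_le; apply/andP; split.
    apply: ge_sup; first by exists M.
    by move=> a /eigenvalue_le Sa; exact: (ub_le_sup S_sup.2 Sa).
  apply: ub_le_sup => //; exists M => a /eigenvalue_le Sa.
  exact: (ub_le_sup S_sup.2 Sa).
split=> //.
by have [x x1 xM] := eigenvalue_le _ eigM; exists x.
Qed.

Lemma lambda_minE n (A : 'M[R]_n) : lambda_min A = - lambda_max (- A).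
Proof.
rewrite /lambda_min /inf /lambda_max; congr (- sup _); apply/seteqP; split=> a /=.
  by move=> [b /eigenvalueP[v vA v0] <-]; apply/eigenvalueP; exists v => //;
    rewrite mulmxN vA scaleNr.
move=> /eigenvalueP[v vA v0]; exists (- a); last exact: opprK.
by apply/eigenvalueP; exists v => //; rewrite scaleNr -vA mulmxN opprK.
Qed.

End rayleigh.

(** * Weighted quadratic forms *)

Section weighted_forms.
Variables (R : realType) (p : nat) (nu : set 'I_p -> \bar R).
Hypothesis nu_ge0 : forall A, (0 <= nu A)%E.
Implicit Types W C D : 'M[R]_p.

Lemma weighted_formE W C h :
  weighted_form nu W C h =
  qform (fun j k => C j k * W j k) (fun j => h j * fine (nu [set j])).
Proof. by apply: eq_bigr => j _; apply: eq_bigr => k _; ring. Qed.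

Lemma weighted_formN W C h :
  weighted_form nu (- W) C h = - weighted_form nu W C h.
Proof.
rewrite -sumrN; apply: eq_bigr => j _; rewrite -sumrN.
by apply: eq_bigr => k _; rewrite mxE; ring.
Qed.

(** Homogeneity extends the bound from the unit sphere to every vector. A vector of norm zero lives
    on points of zero mass, where the form vanishes as well. *)
Lemma weighted_form_bound W C M x :
  (forall h, unit_norm nu h -> weighted_form nu W C h <= M) ->
  weighted_form nu W C x <= M * \sum_j x j ^+ 2 * fine (nu [set j]).
Proof.
move=> CM; set s := \sum_j _.
have term_ge0 j : 0 <= x j ^+ 2 * fine (nu [set j]).
  by rewrite mulr_ge0 ?sqr_ge0 ?fine_ge0.
have [s0|s0] := eqVneq s 0.
  have xa0 j : x j * fine (nu [set j]) = 0.
    move/eqP: s0; rewrite psumr_eq0// => /allP/(_ j (mem_index_enum _)).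
    by rewrite mulf_eq0 sqrf_eq0 => /orP[] /eqP ->; rewrite (mul0r, mulr0).
  rewrite s0 mulr0 weighted_formE /qform big1// => j _; apply: big1 => k _.
  by rewrite xa0 mulr0 mul0r.
have s_gt0 : 0 < s by rewrite lt_neqAle eq_sym s0 sumr_ge0.
have y1 : unit_norm nu (fun j => (Num.sqrt s)^-1 * x j).
  rewrite /unit_norm /=; under eq_bigr do rewrite exprMn -mulrA.
  by rewrite -mulr_sumr -/s exprVn sqr_sqrtr ?mulVf// ltW.
have := CM _ y1; rewrite !weighted_formE.
under [X in qform _ X]eq_fun do rewrite -mulrA.
rewrite qformZ exprVn sqr_sqrtr ?(ltW s_gt0)//.
by rewrite ler_pdivrMl// mulrC.
Qed.

(** The bound for [C] says that [B], the difference between [M] times the squared norm and the form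
    of [C], is positive semidefinite. Pairing [B] with the positive semidefinite matrix of entries
    [h j * h k * G j k] gives the bound for [D]: the unit diagonal of [G] turns the first term into
    [M]. *)
Lemma weighted_form_schur_le W C D (G : 'I_p -> 'I_p -> R) M :
  (forall j k, W j k = W k j) -> (forall j k, C j k = C k j) ->
  psd G -> (forall j, G j j = 1) -> (forall j k, D j k = C j k * G j k) ->
  (forall h, unit_norm nu h -> weighted_form nu W C h <= M) ->
  forall h, unit_norm nu h -> weighted_form nu W D h <= M.
Proof.
move=> sW sC pG G1 DE CM h h1.
pose a j := fine (nu [set j]).
pose B j k := M * a j *+ (j == k) - C j k * W j k * a j * a k.
have sB j k : B j k = B k j.
  rewrite /B sC sW eq_sym; have [->//|_] := eqVneq; last by rewrite !mulr0n; ring.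
have diagE (F : 'I_p -> 'I_p -> R) :
    \sum_j \sum_k (M * a j *+ (j == k)) * F j k = M * \sum_j a j * F j j.
  rewrite mulr_sumr; apply: eq_bigr => j _.
  rewrite (bigD1 j)//= eqxx mulr1n big1 ?addr0 ?mulrA// => k /negPf kj.
  by rewrite eq_sym kj mulr0n mul0r.
have pB : psd B.
  move=> x; have := weighted_form_bound x CM; rewrite -subr_ge0; congr (_ <= _).
  transitivity (M * (\sum_j a j * (x j * x j)) - weighted_form nu W C x).
    by congr (M * _ - _); apply: eq_bigr => j _; rewrite /a; ring.
  rewrite -(diagE (fun j k => x j * x k)) -sumrB; apply: eq_bigr => j _.
  by rewrite -sumrB; apply: eq_bigr => k _; rewrite /B /a; ring.
have pGh : psd (fun j k => h j * h k * G j k).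
  move=> x; have := pG (fun j => h j * x j); congr (_ <= _).
  by apply: eq_bigr => j _; apply: eq_bigr => k _; ring.
have := schur_sum_ge0 sB pB pGh.
have -> : \sum_i \sum_j B i j * (h i * h j * G i j) =
    M * \sum_j a j * (h j * h j * G j j) - weighted_form nu W D h.
  rewrite -(diagE (fun j k => h j * h k * G j k)) -sumrB; apply: eq_bigr => j _.
  by rewrite -sumrB; apply: eq_bigr => k _; rewrite /B /a DE; ring.
rewrite [X in M * X](_ : _ = 1) ?mulr1 ?subr_ge0//.
rewrite -[RHS]h1; apply: eq_bigr => j _; rewrite G1 /a; ring.
Qed.

Lemma form_max_schur_le W C D (G : 'I_p -> 'I_p -> R) :
  (forall j k, W j k = W k j) -> (forall j k, C j k = C k j) ->
  psd G -> (forall j, G j j = 1) -> (forall j k, D j k = C j k * G j k) ->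
  (form_max nu W D <= form_max nu W C)%E.
Proof.
move=> sW sC pG G1 DE; apply: ge_ereal_sup => _ [h h1 <-].
have ub x : unit_norm nu x -> ((weighted_form nu W C x)%:E <= form_max nu W C)%E.
  by move=> x1; apply: ereal_sup_ubound; exists x.
move: (form_max nu W C) ub => [M| |] ub; [|exact: leey|by have := ub _ h1].
by rewrite lee_fin; apply: (weighted_form_schur_le sW sC pG G1 DE).
Qed.

(** Negating the weights exchanges infimum and supremum, so each lower bound is an upper bound for
    [- W]. *)
Lemma form_minN W C : form_min nu W C = (- form_max nu (- W) C)%E.
Proof.
rewrite /form_min /ereal_inf /form_max; congr (- ereal_sup _)%E.
apply/seteqP; split=> x /=.
  by move=> [_ [h h1 <-] <-]; exists h => //; rewrite weighted_formN.
move=> [h h1 <-]; exists (weighted_form nu W C h)%:E; first by exists h.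
by rewrite weighted_formN.
Qed.

Lemma form_min_schur_ge W C D (G : 'I_p -> 'I_p -> R) :
  (forall j k, W j k = W k j) -> (forall j k, C j k = C k j) ->
  psd G -> (forall j, G j j = 1) -> (forall j k, D j k = C j k * G j k) ->
  (form_min nu W C <= form_min nu W D)%E.
Proof.
move=> sW sC pG G1 DE; rewrite !form_minN leeN2.
by apply: (form_max_schur_le _ sC pG G1 DE) => j k; rewrite !mxE sW.
Qed.

End weighted_forms.

(** * The counting measure: weighted forms and extreme eigenvalues *)

Section counting_form.
Variables (R : realType) (n : nat).
Implicit Types W C : 'M[R]_n.+1.

Lemma fine_counting1 (j : 'I_n.+1) : fine (counting [set j] : \bar R) = 1.
Proof. by rewrite /counting asboolT ?finmap.cardfs1 ?fset_set1 ?finmap.cardfs1. Qed.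

Lemma unit_norm_countingE (h : 'I_n.+1 -> R) :
  unit_norm counting h = (\sum_j h j ^+ 2 = 1).
Proof.
by rewrite /unit_norm /=; under eq_bigr do rewrite fine_counting1 mulr1.
Qed.

Lemma weighted_form_countingE W C h :
  weighted_form counting W C h = qform (schur_prod C W) h.
Proof.
rewrite weighted_formE; apply: eq_bigr => j _; apply: eq_bigr => k _.
by rewrite !fine_counting1 !mulr1 mxE.
Qed.

Lemma form_max_counting W C : (schur_prod C W)^T = schur_prod C W ->
  form_max counting W C = (lambda_max (schur_prod C W))%:E.
Proof.
move=> sCW; have [ub [h h1 hE]] := lambda_maxP sCW.
apply/eqP; rewrite eq_le; apply/andP; split.
  apply: ge_ereal_sup => _ [x + <-]; rewrite unit_norm_countingE => x1.
  by rewrite weighted_form_countingE lee_fin (le_trans (ub x))// x1 mulr1.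
apply: ereal_sup_ubound; exists h; first by rewrite unit_norm_countingE.
by rewrite weighted_form_countingE hE.
Qed.

Lemma form_min_counting W C : (schur_prod C W)^T = schur_prod C W ->
  form_min counting W C = (lambda_min (schur_prod C W))%:E.
Proof.
move=> sCW; have E : schur_prod C (- W) = - schur_prod C W.
  by apply/matrixP => j k; rewrite !mxE mulrN.
rewrite form_minN form_max_counting E ?lambda_minE//.
by rewrite linearN /= sCW.
Qed.

End counting_form.

(** * Integrals of bounded measurable functions *)

(** A class closed under ring operations, sections and partial integration, whose members are
    integrable for every probability. The covariance inequality is first proved inside it. *)
Definition bmeas d (T : measurableType d) (R : realType) (f : T -> R) : Prop :=
  measurable_fun setT f /\ exists M, forall x, `|f x| <= M.

Section bounded_measurable.
Context d (T : measurableType d) (R : realType).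
Implicit Types f g : T -> R.

Lemma bmeas_cst (c : R) : bmeas (fun _ : T => c).
Proof. by split; [exact: measurable_cst|exists `|c|]. Qed.

Lemma bmeasD f g : bmeas f -> bmeas g -> bmeas (fun x => f x + g x).
Proof.
move=> [mf [M fM]] [mg [N gN]]; split; first exact: measurable_funD.
by exists (M + N) => x; rewrite (le_trans (ler_normD _ _))// lerD.
Qed.

Lemma bmeasM f g : bmeas f -> bmeas g -> bmeas (fun x => f x * g x).
Proof.
move=> [mf [M fM]] [mg [N gN]]; split; first exact: measurable_funM.
by exists (M * N) => x; rewrite normrM ler_pM.
Qed.

Lemma bmeasB f g : bmeas f -> bmeas g -> bmeas (fun x => f x - g x).
Proof.
move=> [mf [M fM]] [mg [N gN]]; split; first exact: measurable_funB.
by exists (M + N) => x; rewrite (le_trans (ler_normB _ _))// lerD.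
Qed.

Lemma bmeasX f : bmeas f -> bmeas (fun x => f x ^+ 2).
Proof. by move=> bf; exact: bmeasM. Qed.

Lemma bmeas_sum (I : Type) (s : seq I) (Q : pred I) (f : I -> T -> R) :
  (forall i, Q i -> bmeas (f i)) -> bmeas (fun x => \sum_(i <- s | Q i) f i x).
Proof.
move=> bf; elim: s => [|i s IHs].
  have -> : (fun x => \sum_(i <- [::] | Q i) f i x) = fun=> 0 :> R.
    by apply/funext => x; rewrite big_nil.
  exact: bmeas_cst.
have -> : (fun x => \sum_(i <- i :: s | Q i) f i x) = (fun x =>
    if Q i then f i x + \sum_(j <- s | Q j) f j x
    else \sum_(j <- s | Q j) f j x).
  by apply/funext => x; rewrite big_cons.
by case: (Q i) (bf i) => // /(_ isT) bfi; exact: bmeasD.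
Qed.

Lemma bmeas_comp d' (T' : measurableType d') (h : T' -> T) f :
  measurable_fun setT h -> bmeas f -> bmeas (f \o h).
Proof.
move=> mh [mf [M fM]]; split; first exact: measurableT_comp.
by exists M => x; exact: fM.
Qed.

Variable P : probability T R.

Lemma bmeas_integrable f : bmeas f -> P.-integrable setT (EFin \o f).
Proof.
move=> [mf [M fM]]; apply: measurable_bounded_integrable => //.
  by rewrite (le_lt_trans (probability_le1 _ _))// ltry.
exists M; split; first exact: num_real.
by move=> N MN x _ /=; rewrite (le_trans (fM x))// ltW.
Qed.

Lemma RintD f g : bmeas f -> bmeas g ->
  \int[P]_x (f x + g x) = \int[P]_x f x + \int[P]_x g x.
Proof. by move=> bf bg; rewrite RintegralD//; exact: bmeas_integrable. Qed.

Lemma RintB f g : bmeas f -> bmeas g ->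
  \int[P]_x (f x - g x) = \int[P]_x f x - \int[P]_x g x.
Proof. by move=> bf bg; rewrite RintegralB//; exact: bmeas_integrable. Qed.

Lemma RintZ c f : bmeas f -> \int[P]_x (c * f x) = c * \int[P]_x f x.
Proof. by move=> bf; rewrite RintegralZl//; exact: bmeas_integrable. Qed.

Lemma Rint_cst c : \int[P]_x c = c.
Proof. by rewrite Rintegral_cst//= probability_setT mulr1. Qed.

Lemma Rint_sum (I : Type) (s : seq I) (Q : pred I) (f : I -> T -> R) :
  (forall i, bmeas (f i)) ->
  \int[P]_x (\sum_(i <- s | Q i) f i x) = \sum_(i <- s | Q i) \int[P]_x f i x.
Proof.
move=> bf; elim: s => [|i s IHs].
  by under eq_Rintegral do rewrite big_nil; rewrite Rint_cst big_nil.
under eq_Rintegral do rewrite big_cons; rewrite big_cons; case: ifP => // _.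
by rewrite RintD ?IHs//; exact: bmeas_sum.
Qed.

Lemma le_Rint f g : bmeas f -> bmeas g -> (forall x, f x <= g x) ->
  \int[P]_x f x <= \int[P]_x g x.
Proof.
by move=> bf bg fg; apply: le_Rintegral => //; exact: bmeas_integrable.
Qed.

Lemma Rint_EFin f : bmeas f -> (\int[P]_x (f x)%:E = (\int[P]_x f x)%:E)%E.
Proof.
by move=> bf; rewrite /Rintegral fineK//; apply: integrable_fin_num => //;
  exact: bmeas_integrable.
Qed.

Lemma norm_Rint_le f M : bmeas f -> (forall x, `|f x| <= M) ->
  `|\int[P]_x f x| <= M.
Proof.
move=> bf fM.
apply: (le_trans (le_normr_Rintegral _ (bmeas_integrable bf))) => //.
rewrite -[leRHS](Rint_cst M); apply: le_Rint => //; last exact: bmeas_cst.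
split; first by apply: measurableT_comp bf.1.
by exists M => x; rewrite normr_id.
Qed.

End bounded_measurable.

(** * Fubini's theorem for bounded functions *)

Section bounded_fubini.
Context d1 d2 (T1 : measurableType d1) (T2 : measurableType d2) (R : realType).
Variables (P1 : probability T1 R) (P2 : probability T2 R) (F : T1 * T2 -> R).
Hypothesis bF : bmeas F.

Lemma bmeas_section1 x : bmeas (fun y => F (x, y)).
Proof. exact: (bmeas_comp (pair1_measurable x) bF). Qed.

Lemma bmeas_section2 y : bmeas (fun x => F (x, y)).
Proof. exact: (bmeas_comp (pair2_measurable y) bF). Qed.

Let intF : (P1 \x P2)%E.-integrable setT (EFin \o F).
Proof. exact: (@bmeas_integrable _ _ _ (P1 \x P2)%E _ bF). Qed.

Lemma bmeas_Rint1 : bmeas (fun x => \int[P2]_y F (x, y)).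
Proof.
split; last first.
  have [_ [M FM]] := bF; exists M => x; apply: norm_Rint_le => //.
  exact: bmeas_section1.
apply/measurable_EFinP.
(* The Dirac mass is a dummy first factor: the partial integral involves [P2] alone. *)
have := measurable_fubini_F (bmeas_integrable (\d_(point : T1) \x P2)%E bF).
apply: eq_measurable_fun => x _ /=.
by rewrite /fubini_F Rint_EFin//; exact: bmeas_section1.
Qed.

Lemma bmeas_Rint2 : bmeas (fun y => \int[P1]_x F (x, y)).
Proof.
split; last first.
  have [_ [M FM]] := bF; exists M => y; apply: norm_Rint_le => //.
  exact: bmeas_section2.
apply/measurable_EFinP.
have := measurable_fubini_G (bmeas_integrable (P1 \x \d_(point : T2))%E bF).
apply: eq_measurable_fun => y _ /=.
by rewrite /fubini_G Rint_EFin//; exact: bmeas_section2.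
Qed.

Lemma Rint_fubini1 :
  \int[P1]_x \int[P2]_y F (x, y) = \int[(P1 \x P2)%E]_z F z.
Proof.
apply: EFin_inj; rewrite -Rint_EFin; last exact: bmeas_Rint1.
rewrite -(@Rint_EFin _ _ _ (P1 \x P2)%E)// -(integral12_prod_meas1 intF).
apply: eq_integral => x _.
by rewrite /fubini_F /= -Rint_EFin//; exact: bmeas_section1.
Qed.

Lemma Rint_fubini2 :
  \int[P2]_y \int[P1]_x F (x, y) = \int[(P1 \x P2)%E]_z F z.
Proof.
apply: EFin_inj; rewrite -Rint_EFin; last exact: bmeas_Rint2.
rewrite -(@Rint_EFin _ _ _ (P1 \x P2)%E)// -(integral21_prod_meas1 intF).
apply: eq_integral => x _.
by rewrite /fubini_G /= -Rint_EFin//; exact: bmeas_section2.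
Qed.

End bounded_fubini.

(** * Independence of the past sums and the next summand *)

Lemma Rint_distribution d d1 (T : measurableType d) (T1 : measurableType d1)
    (R : realType) (P : probability T R) (V : {mfun T >-> T1}) (f : T1 -> R) :
  bmeas f ->
  \int[distribution P V]_y f y = \int[P]_t f (V t).
Proof.
move=> bf; congr fine; rewrite integral_distribution//.
  by apply/measurable_EFinP; exact: bf.1.
apply: bmeas_integrable; apply: bmeas_comp => //; exact: measurable_funPT.
Qed.

(** Independence makes the joint law the product of the marginals, by uniqueness of the product
    measure on rectangles; Fubini does the rest. *)
Lemma Rint_independent d d1 d2 (T : measurableType d) (T1 : measurableType d1)
    (T2 : measurableType d2) (R : realType) (P : probability T R)
    (V : {mfun T >-> T1}) (Z : {mfun T >-> T2})
    (F : T1 * T2 -> R) :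
  (forall A B, measurable A -> measurable B ->
    P (V @^-1` A `&` Z @^-1` B) = (P (V @^-1` A) * P (Z @^-1` B))%E) ->
  bmeas F ->
  \int[P]_t F (V t, Z t) = \int[P]_t \int[distribution P Z]_y F (V t, y).
Proof.
move=> indep bF.
have mVZ : measurable_fun setT (fun t => (V t, Z t)).
  by apply: measurable_fun_pair; exact: measurable_funPT.
pose VZ : {mfun T >-> (T1 * T2)%type} :=
  HB.pack (fun t => (V t, Z t)) (isMeasurableFun.Build _ _ _ _ _ mVZ).
rewrite -[LHS](Rint_distribution P VZ bF).
rewrite -(@Rint_distribution _ _ _ _ _ P V
  (fun x => \int[distribution P Z]_y F (x, y))); last first.
  exact: bmeas_Rint1.
rewrite Rint_fubini1//; congr fine; apply: eq_measure_integral => A mA _.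
exact/esym/product_measure_unique.
Qed.


Section iid_sums.
Context d (T : measurableType d) (R : realType) (P : probability T R).
Variable Y : nat -> {RV P >-> R}.
Hypothesis Y_iid : iid Y.

Let X := partial_sum Y.

(** A pi-system generating the sigma-algebra of the summands of index 1 to [l], so independence from
    the past need only be checked on it. *)
Definition past_cylinders l : set (set T) :=
  [set E | exists2 A : nat -> set R, (forall i, measurable (A i)) &
    E = \bigcap_(i in [set` iota 1 l]) Y i @^-1` A i].

Lemma measurable_past l : past_cylinders l `<=` measurable.
Proof.
move=> _ [A mA ->]; apply: fin_bigcap_measurable => [|i _].
  exact: finite_seq.
exact: measurable_funPTI.
Qed.

Lemma past_cylinder_preimage l i A : (0 < i <= l)%N -> measurable A ->
  past_cylinders l (Y i @^-1` A).
Proof.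
move=> /andP[i0 il] mA; exists (fun k => if k == i then A else setT).
  by move=> k; case: ifP.
apply/seteqP; split=> [t At k _ /=|t /(_ i)/=]; last first.
  by rewrite eqxx; apply; rewrite mem_iota i0 add1n ltnS.
by have [->|//] := eqVneq k i.
Qed.

Lemma past_cylinders_setI l : setI_closed (past_cylinders l).
Proof.
move=> _ _ [A mA ->] [B mB ->]; exists (fun i => A i `&` B i).
  by move=> i; exact: measurableI.
by rewrite -bigcapI; apply: eq_bigcapr => i _; rewrite preimage_setI.
Qed.

(** Both sides are finite measures in [E], a restriction and a rescaling of [P], and they agree on
    the pi-system of cylinders. *)
Lemma past_independent l E B : <<s past_cylinders l >> E -> measurable B ->
  P (E `&` Y l.+1 @^-1` B) = (P E * P (Y l.+1 @^-1` B))%E.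
Proof.
move=> sE mB.
have mF : measurable (Y l.+1 @^-1` B) by exact: measurable_funPTI.
have PF : P (Y l.+1 @^-1` B) \is a fin_num by exact: fin_num_measure.
pose r : {nonneg R} := NngNum (fine_ge0 (measure_ge0 P (Y l.+1 @^-1` B))).
have rE : (r%:num)%:E = P (Y l.+1 @^-1` B) by exact: fineK.
rewrite muleC -[LHS]/(mrestr P mF E).
rewrite -rE -[RHS]/(mscale r P E).
apply: (g_sigma_algebra_measure_unique (past_cylinders l) (@measurable_past l)
  (fun=> setT)) => //.
- move=> _; exists (fun=> setT) => //.
  by apply/seteqP; split.
- by apply/seteqP; split=> // t _; exists 0%N.
- exact: past_cylinders_setI.
- move=> _ [A mA ->]; rewrite -[RHS]/((r%:num)%:E * _)%E rE -[LHS]/(P (_ `&` _)) muleC.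
  (* Mutual independence is applied twice, to the indices 1 to [l.+1] with [A'] and to 1 to [l] with
     [A]; the quotient is the factor of index [l.+1]. *)
  pose A' i := if i == l.+1 then B else A i.
  have mA' i : measurable (A' i) by rewrite /A'; case: ifP.
  have l1 : l.+1 \notin iota 1 l by rewrite mem_iota add1n ltnn andbF.
  have A'E i : i \in iota 1 l -> A' i = A i.
    by rewrite /A'; case: eqP => // ->; rewrite (negPf l1).
  have := Y_iid.1 (l.+1 :: iota 1 l) A'; rewrite /= l1 iota_uniq => /(_ isT mA').
  have -> : \bigcap_(i in [set` l.+1 :: iota 1 l]) Y i @^-1` A' i =
      \bigcap_(i in [set` iota 1 l]) Y i @^-1` A i `&` Y l.+1 @^-1` B.
    apply/seteqP; split=> [t h|t [h1 h2] i /=].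
      split=> [i /= il|].
        by rewrite -A'E//; apply: h => /=; rewrite in_cons il orbT.
      by have := h l.+1; rewrite /A' /= in_cons eqxx; apply.
    rewrite in_cons => /predU1P[->|il]; first by rewrite /A' eqxx.
    by rewrite A'E//; exact: h1.
  move=> ->; rewrite big_cons {1}/A' eqxx muleC; congr (_ * _)%E.
  rewrite (Y_iid.1 (iota 1 l) A)// ?iota_uniq//.
  by apply: eq_big_seq => i /A'E ->.
- move=> _; rewrite /mrestr (le_lt_trans (probability_le1 _ _))// ?ltry//.
  by rewrite setTI.
Qed.

Lemma measurable_partial_sum j : measurable_fun setT (X j).
Proof. by apply: measurable_sum => i; exact: measurable_funPT. Qed.

Lemma past_partial_sum l j : (j <= l)%N ->
  @measurable_fun _ _ (g_sigma_algebraType (past_cylinders l)) _ setT (X j).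
Proof.
move=> jl.
have -> : X j = (fun t => \sum_(i < j) Y i.+1 t).
  by apply/funext => t; rewrite /X /partial_sum big_add1 big_mkord.
apply: measurable_sum => i _ A mA; rewrite setTI.
apply: sub_sigma_algebra; apply: past_cylinder_preimage => //=.
exact: leq_trans jl.
Qed.

Lemma partial_sum_independent l j k A B : (j <= l)%N -> (k <= l)%N ->
  measurable A -> measurable B ->
  P ((fun t => (X j t, X k t)) @^-1` A `&` Y l.+1 @^-1` B) =
  (P ((fun t => (X j t, X k t)) @^-1` A) * P (Y l.+1 @^-1` B))%E.
Proof.
move=> jl kl mA mB; apply: past_independent => //.
have := measurable_fun_pair (past_partial_sum jl) (past_partial_sum kl).
by move=> /(_ measurableT A mA); rewrite setTI.
Qed.

Let mu := distribution P (Y 0%N).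

Lemma Rint_same_distribution i (f : R -> R) : bmeas f ->
  \int[distribution P (Y i)]_y f y = \int[mu]_y f y.
Proof.
by move=> bf; congr fine; apply: eq_measure_integral => A mA _; exact: Y_iid.2.
Qed.

Lemma Rint_iid i (f : R -> R) : bmeas f ->
  \int[P]_t f (Y i t) = \int[mu]_y f y.
Proof.
by move=> bf; rewrite -(Rint_same_distribution i bf) Rint_distribution.
Qed.

(** Conditioning on the first [l] summands integrates [Y l.+1] out against the common law. Two past
    sums are kept because covariances involve two of them. *)
Lemma Rint_next l j k (F : R * R * R -> R) : (j <= l)%N -> (k <= l)%N ->
  bmeas F ->
  \int[P]_t F (X j t, X k t, Y l.+1 t) =
  \int[P]_t \int[mu]_y F (X j t, X k t, y).
Proof.
move=> jl kl bF.
have mV : measurable_fun setT (fun t => (X j t, X k t)).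
  by apply: measurable_fun_pair; exact: measurable_partial_sum.
pose V : {mfun T >-> (R * R)%type} :=
  HB.pack (fun t => (X j t, X k t)) (isMeasurableFun.Build _ _ _ _ _ mV).
rewrite (@Rint_independent _ _ _ _ _ _ _ P V (Y l.+1))//; last first.
  by move=> A B mA mB; exact: partial_sum_independent.
apply: eq_Rintegral => t _; rewrite Rint_same_distribution//.
exact: bmeas_section1.
Qed.

End iid_sums.

(** * The averaging operator of a random walk *)

(** The Markov operator of the walk with step law [mu]: its n-th iterate at x is the mean of [f]
    after n steps from x. *)
Definition shift_mean (R : realType) (mu : probability R R) (f : R -> R) : R -> R :=
  fun x => \int[mu]_y f (x + y).

Section shift_mean.
Variables (R : realType) (mu : probability R R).
Implicit Types f g : R -> R.

Local Notation K := (shift_mean mu).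

Lemma bmeas_shift f : bmeas f -> bmeas (fun z : R * R => f (z.1 + z.2)).
Proof.
move=> bf; apply: (bmeas_comp (h := fun z : R * R => z.1 + z.2)) => //.
exact: measurable_funD.
Qed.

Lemma bmeas_shift_mean f : bmeas f -> bmeas (K f).
Proof. by move=> bf; exact: (bmeas_Rint1 mu (bmeas_shift bf)). Qed.

Lemma bmeas_translate f x : bmeas f -> bmeas (fun y : R => f (x + y)).
Proof. by move=> bf; exact: (bmeas_section1 (bmeas_shift bf)). Qed.

Lemma bmeas_iter_shift_mean n f : bmeas f -> bmeas (iter n K f).
Proof. by move=> bf; elim: n => //= n; exact: bmeas_shift_mean. Qed.

Lemma iter_shift_mean_le n f g x : bmeas f -> bmeas g ->
  (forall x, f x <= g x) -> iter n K f x <= iter n K g x.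
Proof.
move=> bf bg fg; elim: n x => //= n IHn x.
by apply: le_Rint => //; exact/bmeas_translate/bmeas_iter_shift_mean.
Qed.

Lemma iter_shift_mean_sum n (I : Type) (s : seq I) (Q : pred I)
    (f : I -> R -> R) x : (forall i, bmeas (f i)) ->
  iter n K (fun x => \sum_(i <- s | Q i) f i x) x =
  \sum_(i <- s | Q i) iter n K (f i) x.
Proof.
move=> bf; elim: n x => //= n IHn x; rewrite /shift_mean.
under eq_Rintegral do rewrite IHn.
by rewrite Rint_sum// => i; exact/bmeas_translate/bmeas_iter_shift_mean.
Qed.

Lemma iter_shift_meanD n f g x : bmeas f -> bmeas g ->
  iter n K (fun x => f x + g x) x = iter n K f x + iter n K g x.
Proof.
move=> bf bg; elim: n x => //= n IHn x; rewrite /shift_mean.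
under eq_Rintegral do rewrite IHn.
by rewrite RintD//; exact/bmeas_translate/bmeas_iter_shift_mean.
Qed.

Lemma iter_shift_meanZ n c f x : bmeas f ->
  iter n K (fun x => c * f x) x = c * iter n K f x.
Proof.
move=> bf; elim: n x => //= n IHn x; rewrite /shift_mean.
under eq_Rintegral do rewrite IHn.
by rewrite RintZ//; exact/bmeas_translate/bmeas_iter_shift_mean.
Qed.

(* With [phi y z = g (x + y + z)], [A y] its mean over [z] and [c] its total
   mean, this is the mean of [(phi y z - A y - A z + c) ^ 2]. *)
Lemma shift_mean_sqr_convex g x : bmeas g ->
  2 * K (fun x => K g x ^+ 2) x <=
  K (K (fun x => g x ^+ 2)) x + K (K g) x ^+ 2.
Proof.
(* The hypothesis has the shape of the ten-term expansion of the square below; [b] stands for all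
   four means equal to [K (fun x => K g x ^+ 2) x]. *)
have lin (a b c : R) : 0 <= a + (b + (b + (2 * c ^+ 2 + (- 2 * b + (- 2 * b +
    (2 * c * c + (- 2 * c * c + (- 2 * c * c + c ^+ 2)))))))) -> 2 * b <= a + c ^+ 2.
  by lra.
move=> bg; pose A y := K g (x + y); pose c := K (K g) x.
pose phi (w : R * R) := g (x + w.1 + w.2).
have bA : bmeas A by exact/bmeas_translate/bmeas_shift_mean.
have bphi : bmeas phi.
  apply: (bmeas_comp (h := fun z : R * R => x + z.1 + z.2)) bg.
  by apply: measurable_funD => //; exact: measurable_funD.
have bA1 : bmeas (fun w : R * R => A w.1) by exact: (bmeas_comp measurable_fst).
have bA2 : bmeas (fun w : R * R => A w.2) by exact: (bmeas_comp measurable_snd).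
pose I (F : R * R -> R) := \int[(mu \x mu)%E]_w F w.
have IE F : bmeas F -> I F = \int[mu]_y \int[mu]_z F (y, z).
  by move=> bF; exact/esym/Rint_fubini1.
have IE2 F : bmeas F -> I F = \int[mu]_z \int[mu]_y F (y, z).
  by move=> bF; exact/esym/Rint_fubini2.
have Iphi2 : I (fun w => phi w ^+ 2) = K (K (fun x => g x ^+ 2)) x.
  by rewrite (IE _ (bmeasX bphi)).
have Iphi : I phi = c by rewrite (IE _ bphi).
have IA1 : I (fun w => A w.1) = c.
  by rewrite (IE _ bA1); apply: eq_Rintegral => y _ /=; rewrite Rint_cst.
have IA2 : I (fun w => A w.2) = c by rewrite (IE _ bA2) /= Rint_cst.
have IA11 : I (fun w => A w.1 ^+ 2) = K (fun x => K g x ^+ 2) x.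
  by rewrite IE; [under eq_Rintegral do rewrite /= Rint_cst|exact: bmeasX].
have IA22 : I (fun w => A w.2 ^+ 2) = K (fun x => K g x ^+ 2) x.
  by rewrite IE /= ?Rint_cst//; exact: bmeasX.
have IA12 : I (fun w => A w.1 * A w.2) = c ^+ 2.
  rewrite IE; last exact: bmeasM.
  under eq_Rintegral do rewrite /= RintZ//.
  under eq_Rintegral do rewrite mulrC.
  by rewrite RintZ// expr2.
have IphiA1 : I (fun w => A w.1 * phi w) = K (fun x => K g x ^+ 2) x.
  rewrite IE; last exact: bmeasM.
  apply: eq_Rintegral => y _ /=; rewrite RintZ ?expr2//.
  exact: (bmeas_section1 bphi).
(* As [phi] is symmetric in its two coordinates, integrating out the first one also yields [A],
   hence the other order of integration. *)
have IphiA2 : I (fun w => A w.2 * phi w) = K (fun x => K g x ^+ 2) x.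
  rewrite IE2; last exact: bmeasM.
  apply: eq_Rintegral => z _ /=.
  rewrite RintZ ?expr2; last exact: (bmeas_section2 bphi).
  by congr (_ * _); apply: eq_Rintegral => y _; rewrite /phi /= addrAC.
have : 0 <= I (fun w => (phi w - A w.1 - A w.2 + c) ^+ 2).
  by apply: Rintegral_ge0 => w _; exact: sqr_ge0.
have -> : I (fun w => (phi w - A w.1 - A w.2 + c) ^+ 2) =
  I (fun w => phi w ^+ 2 + (A w.1 ^+ 2 + (A w.2 ^+ 2 + (2 * (A w.1 * A w.2) +
    (- 2 * (A w.1 * phi w) + (- 2 * (A w.2 * phi w) + (2 * c * phi w +
      (- 2 * c * A w.1 + (- 2 * c * A w.2 + c ^+ 2))))))))).
  by apply: eq_Rintegral => w _; ring.
pose bAA := bmeasM bA1 bA2; pose bAp := bmeasM bA1 bphi; pose bBp := bmeasM bA2 bphi.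
pose bA11 := bmeasX bA1; pose bA22 := bmeasX bA2; pose bp2 := bmeasX bphi.
have bZ k F : bmeas F -> bmeas (fun w : R * R => k * F w).
  by move=> bF; apply: bmeasM => //; exact: bmeas_cst.
have bc : bmeas (fun _ : R * R => c ^+ 2) by exact: bmeas_cst.
rewrite /I !RintD; do ?[apply: bmeasD] => //; do ?[apply: bZ] => //.
rewrite Rint_cst !RintZ// -!/(I _) Iphi2 Iphi IA1 IA2 IA11 IA22 IA12 IphiA1 IphiA2.
exact: lin.
Qed.

(** The inequality of Dembo, Kagan and Shepp for a walk started at x. Let u(k) be the value at x of
    K^k applied to the square of K^(n+1-k) f. By [shift_mean_sqr_convex] this sequence is convex, so
    u(n) lies below the chord from u(0), the last square, to u(n+1). *)
Lemma shift_mean_sqr_le n f x : bmeas f ->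
  n.+1%:R * iter n K (fun x => K f x ^+ 2) x <=
  n%:R * iter n.+1 K (fun x => f x ^+ 2) x + iter n.+1 K f x ^+ 2.
Proof.
elim: n f => [|n IHn] f bf; first by rewrite mul1r mul0r add0r.
have bKf := bmeas_shift_mean bf.
have := IHn _ bKf; rewrite -!iterSr.
set a := iter n K _ x; set b := iter n.+1 K _ x; set z := iter n.+2 K f x.
have bf2 := bmeas_shift_mean (bmeas_shift_mean (bmeasX bf)).
have bKf2 := bmeas_shift_mean (bmeasX bKf).
have bKKf2 := bmeasX (bmeas_shift_mean bKf).
(* Convexity at the last three indices: the pointwise inequality is pushed through [iter n K], which
   is monotone and linear. *)
have : 2 * b <= iter n.+2 K (fun x => f x ^+ 2) x + a.
  rewrite /a /b 2!iterSr [iter n.+1 _ _]iterSr -iter_shift_meanZ//.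
  rewrite -iter_shift_meanD//; apply: iter_shift_mean_le => [||y].
  - by apply: bmeasM => //; exact: bmeas_cst.
  - exact: bmeasD.
  - exact: shift_mean_sqr_convex.
set e := iter n.+2 K _ x => h1 h2.
have h3 : n.+1%:R * (2 * b) <= n.+1%:R * (e + a) by rewrite ler_wpM2l.
have -> : n.+2%:R = n%:R + 2 :> R by rewrite -addn2 natrD.
move: h2 h3; have -> : n.+1%:R = n%:R + 1 :> R by rewrite -addn1 natrD.
by lra.
Qed.

End shift_mean.

(** * Covariances of bounded transforms *)

Section bounded_transforms.
Context d (T : measurableType d) (R : realType) (P : probability T R).
Variable Y : nat -> {RV P >-> R}.
Hypothesis Y_iid : iid Y.

Let X := partial_sum Y.
Local Notation K := (shift_mean (distribution P (Y 0%N))).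

Lemma partial_sum0 t : X 0 t = 0.
Proof. by rewrite /X /partial_sum big_geq. Qed.

Lemma partial_sumS l t : X l.+1 t = X l t + Y l.+1 t.
Proof. by rewrite /X /partial_sum big_nat_recr. Qed.

(** The Markov property: each summand after the j-th is integrated out in turn, starting with the
    last, and costs one application of [K] to [g]. *)
Lemma Rint_partial_sumM j i (f g : R -> R) : bmeas f -> bmeas g ->
  \int[P]_t (f (X j t) * g (X (j + i)%N t)) =
  \int[P]_t (f (X j t) * iter i K g (X j t)).
Proof.
move=> bf; elim: i g => [|i IHi] g bg; first by rewrite addn0.
pose F (w : R * R * R) := f w.1.1 * g (w.1.2 + w.2).
have bF : bmeas F.
  apply: bmeasM.
    apply: (bmeas_comp (h := fun w : R * R * R => w.1.1)) bf.
    by apply: measurableT_comp.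
  apply: (bmeas_comp (h := fun w : R * R * R => w.1.2 + w.2)) bg.
  by apply: measurable_funD => //; apply: measurableT_comp.
rewrite addnS iterSr -(IHi _ (bmeas_shift_mean _ bg)).
under eq_Rintegral do rewrite partial_sumS.
rewrite (Rint_next Y_iid (leq_addr i j) (leqnn _) bF).
by apply: eq_Rintegral => t _; rewrite /F /= RintZ//; exact: bmeas_translate.
Qed.

Lemma Rint_partial_sum l (f : R -> R) : bmeas f ->
  \int[P]_t f (X l t) = iter l K f 0.
Proof.
move=> bf; have := Rint_partial_sumM 0 l (bmeas_cst _ 1) bf.
rewrite add0n.
under eq_Rintegral do rewrite mul1r.
move=> ->; under eq_Rintegral do rewrite mul1r partial_sum0.
exact: Rint_cst.
Qed.

Variables (n : nat) (m : 'I_n -> nat) (f : 'I_n -> R -> R).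
Hypotheses (m_ge1 : forall j, (1 <= m j)%N) (bf : forall j, bmeas (f j)).

(** Mean product of the conditional means of the two transforms given the first [l] summands. This
    reading requires [l] to be at most [m j] and [m k], since natural subtraction truncates. *)
Let e l j k :=
  iter l K (fun x => iter (m j - l) K (f j) x * iter (m k - l) K (f k) x) 0.

Lemma Rint_partial_sum_min j k :
  \int[P]_t (f j (X (m j) t) * f k (X (m k) t)) = e (minn (m j) (m k)) j k.
Proof.
have [mjk|/ltnW mkj] := leqP (m j) (m k).
  rewrite -{1}(subnKC mjk) Rint_partial_sumM// /e subnn -Rint_partial_sum//.
  by apply: bmeasM => //; exact: bmeas_iter_shift_mean.
under eq_Rintegral do rewrite mulrC.
rewrite -{1}(subnKC mkj) Rint_partial_sumM// /e subnn -Rint_partial_sum//.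
  by apply: eq_Rintegral => t _; rewrite mulrC.
by apply: bmeasM => //; exact: bmeas_iter_shift_mean.
Qed.

Let S l x := \sum_(j < n | (l <= m j)%N) iter (m j - l) K (f j) x.

Let b l := iter l K (fun x => S l x ^+ 2) 0.

Let bS l : bmeas (S l).
Proof. by apply: bmeas_sum => j _; exact: bmeas_iter_shift_mean. Qed.

Let iterK_sqr_sum l (Q : pred 'I_n) :
  iter l K (fun x => (\sum_(j < n | Q j) iter (m j - l) K (f j) x) ^+ 2) 0 =
  \sum_j \sum_k (if Q j && Q k then e l j k else 0).
Proof.
have bij j k : bmeas (fun x => iter (m j - l) K (f j) x * iter (m k - l) K (f k) x).
  by apply: bmeasM; exact: bmeas_iter_shift_mean.
transitivity (iter l K (fun x => \sum_(j < n | Q j) \sum_(k < n | Q k)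
    iter (m j - l) K (f j) x * iter (m k - l) K (f k) x) 0).
  congr (iter l K _ 0); apply/funext => x; rewrite expr2 mulr_suml; apply: eq_bigr => j _.
  by rewrite mulr_sumr.
rewrite iter_shift_mean_sum => [|j]; last exact: bmeas_sum.
rewrite big_mkcond; apply: eq_bigr => j _; case: (Q j) => /=; last by rewrite big1.
by rewrite iter_shift_mean_sum => [|k//]; rewrite big_mkcond.
Qed.

(** Applying [K] raises the exponent of each term to [m j - l], so [K (S l.+1)] is [S l] without the
    terms such that [m j = l]. *)
Let next_sqr l :
  iter l K (fun x => K (S l.+1) x ^+ 2) 0 =
  \sum_j \sum_k (if (l < m j)%N && (l < m k)%N then e l j k else 0).
Proof.
rewrite -(iterK_sqr_sum l (fun j => (l < m j)%N)); congr (iter l K _ 0).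
apply/funext => x; congr (_ ^+ 2).
rewrite -[LHS]/(iter 1 K (fun x => \sum_(j < n | (l < m j)%N)
  iter (m j - l.+1) K (f j) x) x) iter_shift_mean_sum; last first.
  by move=> j; exact: bmeas_iter_shift_mean.
apply: eq_bigr => j lj; rewrite -[LHS]/(iter (m j - l.+1).+1 K (f j) x).
by congr (iter _ K _ x); rewrite -subSn.
Qed.

Hypothesis f_centered : forall j, \int[P]_t f j (X (m j) t) = 0.

(** This is [shift_mean_sqr_le] for [S l.+2] started at 0. Its last square is the squared mean of
    [S l.+2] after [l.+2] steps, which vanishes because every transform is centred. *)
Let next_sqr_le l :
  iter l.+1 K (fun x => K (S l.+2) x ^+ 2) 0 / l.+1%:R <= b l.+2 / l.+2%:R.
Proof.
rewrite ler_pdivrMr// mulrAC ler_pdivlMr// mulrC [leRHS]mulrC.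
apply: (le_trans (shift_mean_sqr_le _ l.+1 0 (bS l.+2))).
rewrite -[leRHS]addr0 lerD2l [X in X ^+ 2](_ : _ = 0) ?expr0n//.
rewrite iter_shift_mean_sum => [|j]; last exact: bmeas_iter_shift_mean.
apply: big1 => j lj; rewrite -iterD subnKC// -[RHS](f_centered j).
by rewrite Rint_partial_sum.
Qed.

Lemma bounded_cov_ge0 :
  0 <= \sum_j \sum_k
    (\int[P]_t (f j (X (m j) t) * f k (X (m k) t))) / (minn (m j) (m k))%:R.
Proof.
pose N := \max_j m j; have mN j : (m j <= N)%N by exact: leq_bigmax.
(* The two squares at level [l] differ exactly by the pairs whose smaller index is [l]. *)
have step l : b l - iter l K (fun x => K (S l.+1) x ^+ 2) 0 =
    \sum_j \sum_k (if l == minn (m j) (m k) then e l j k else 0).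
  rewrite next_sqr /b iterK_sqr_sum -sumrB; apply: eq_bigr => j _.
  rewrite -sumrB; apply: eq_bigr => k _; rewrite -!leq_min.
  by case: ltngtP => _; rewrite ?subr0 ?subrr.
(* The form is regrouped by the value [l.+1] of the minimum, which is positive since all [m j]
   are. *)
have -> : \sum_j \sum_k
    (\int[P]_t (f j (X (m j) t) * f k (X (m k) t))) / (minn (m j) (m k))%:R =
    \sum_(0 <= l < N)
      (b l.+1 - iter l.+1 K (fun x => K (S l.+2) x ^+ 2) 0) / l.+1%:R.
  under [RHS]eq_bigr do rewrite step mulr_suml.
  rewrite [RHS]exchange_big /=; apply: eq_bigr => j _.
  under [RHS]eq_bigr do rewrite mulr_suml.
  rewrite [RHS]exchange_big /=; apply: eq_bigr => k _.
  have [l lE] : exists l, minn (m j) (m k) = l.+1.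
    by exists (minn (m j) (m k)).-1; rewrite prednK// leq_min !m_ge1.
  rewrite (bigD1_seq l) ?iota_uniq//=; last first.
    by rewrite mem_index_iota -lE /= (leq_trans (geq_minl _ _)).
  rewrite lE eqxx Rint_partial_sum_min lE big1 ?addr0// => i il.
  by rewrite eqSS (negPf il) mul0r.
(* The lower bound telescopes to [b 1], a mean square: [b N.+1] vanishes because no [m j] exceeds
   the maximum [N]. *)
apply: (@le_trans _ _ (\sum_(0 <= l < N) (b l.+1 / l.+1%:R - b l.+2 / l.+2%:R))).
  rewrite -(opprK (\sum_(0 <= l < N) _)) -sumrN.
  under eq_bigr do rewrite opprB.
  rewrite telescope_sumr// opprB divr1 subr_ge0.
  have -> : b N.+1 = 0.
    rewrite /b iterK_sqr_sum big1// => j _; apply: big1 => k _.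
    by rewrite ltnNge mN.
  rewrite mul0r /b -Rint_partial_sum; last exact: bmeasX.
  by apply: Rintegral_ge0 => t _; exact: sqr_ge0.
apply: ler_sum => l _; rewrite mulrBl lerD2l lerN2; exact: next_sqr_le.
Qed.

End bounded_transforms.

(** * Truncation *)

Section clip.
Variable R : realType.
Implicit Types M x y : R.

Definition clip M x := Num.max (- M) (Num.min x M).

Lemma clip_le M x : 0 <= M -> `|clip M x| <= M.
Proof.
move=> M0; rewrite /clip ler_norml le_max lexx /= ge_max ge_min lexx orbT andbT.
by rewrite (le_trans _ M0)// oppr_le0.
Qed.

Lemma clip_norm_le M x : 0 <= M -> `|clip M x| <= `|x|.
Proof.
move=> M0; rewrite /clip; have [xM|/ltW Mx] := leP x M;
  have [Mx'|/ltW xM'] := leP (- M) _ => //.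
- by rewrite normrN ger0_norm// ler0_norm; lra.
- by rewrite ger0_norm// ger0_norm//; lra.
- by rewrite normrN ger0_norm//; have := normr_ge0 x; lra.
Qed.

Lemma clip_id M x : `|x| <= M -> clip M x = x.
Proof. by rewrite ler_norml => /andP[h1 h2]; rewrite /clip min_l// max_r. Qed.

Lemma clip_lipschitz M x y : `|clip M x - clip M y| <= `|x - y|.
Proof.
rewrite /clip ler_norml; have := ler_norm (x - y).
have := ler_norm (- (x - y)); rewrite normrN.
have [xM|/ltW Mx] := leP x M; have [yM|/ltW My] := leP y M.
- by have [?|/ltW ?] := leP (- M) x; have [?|/ltW ?] := leP (- M) y;
    move=> *; apply/andP; split; lra.
- by have [?|/ltW ?] := leP (- M) x; have [?|/ltW ?] := leP (- M) M;
    move=> *; apply/andP; split; lra.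
- by have [?|/ltW ?] := leP (- M) M; have [?|/ltW ?] := leP (- M) y;
    move=> *; apply/andP; split; lra.
- by have [?|/ltW ?] := leP (- M) M; move=> *; apply/andP; split; lra.
Qed.

Lemma measurable_clip M : measurable_fun setT (clip M).
Proof.
apply: measurable_maxr; first exact: measurable_cst.
by apply: measurable_minr => //; exact: measurable_cst.
Qed.

Lemma bmeas_clip M : 0 <= M -> bmeas (clip M).
Proof.
by move=> M0; split; [exact: measurable_clip|exists M => x; exact: clip_le].
Qed.

Lemma clip_cvg x : clip n%:R x @[n --> \oo] --> x.
Proof.
apply: cvg_near_cst; near=> n; apply: clip_id.
near: n; exact: nbhs_infty_ger.
Unshelve. all: by end_near. Qed.

End clip.

Section clip_integral.
Context d (T : measurableType d) (R : realType) (P : probability T R).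
Implicit Types U V : T -> R.

Lemma Rint_clipM_cvg U V : measurable_fun setT U -> measurable_fun setT V ->
  P.-integrable setT (EFin \o (fun t => U t * V t)) ->
  \int[P]_t (clip n%:R (U t) * clip n%:R (V t)) @[n --> \oo] -->
  \int[P]_t (U t * V t).
Proof.
move=> mU mV iUV; apply: fine_cvg; rewrite fineK; last exact: integrable_fin_num.
apply: (dominated_cvg _ _ _ _ (integrable_norm iUV)) => //.
- move=> n; apply/measurable_EFinP; apply: measurable_funM;
    by apply: measurableT_comp => //; exact: measurable_clip.
- move=> t _; apply: cvg_EFin; first by near=> n.
  by apply: cvgM; exact: clip_cvg.
- by move=> n t _; rewrite /= lee_fin !normrM ler_pM// clip_norm_le.
Unshelve. all: by end_near. Qed.

Lemma Rint_clip_cvg U : measurable_fun setT U ->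
  P.-integrable setT (EFin \o U) ->
  \int[P]_t clip n%:R (U t) @[n --> \oo] --> \int[P]_t U t.
Proof.
move=> mU iU; apply: fine_cvg; rewrite fineK; last exact: integrable_fin_num.
apply: (dominated_cvg _ _ _ _ (integrable_norm iU)) => //.
- move=> n; apply/measurable_EFinP.
  by apply: measurableT_comp => //; exact: measurable_clip.
- by move=> t _; apply: cvg_EFin; [near=> n|exact: clip_cvg].
- by move=> n t _; rewrite /= lee_fin clip_norm_le.
Unshelve. all: by end_near. Qed.

Definition sqint U := measurable_fun setT U /\
  P.-integrable setT (EFin \o (fun t => U t ^+ 2)).

Lemma sqint_bmeas U : bmeas U -> sqint U.
Proof. by move=> bU; split; [exact: bU.1|exact/bmeas_integrable/bmeasX]. Qed.

Lemma sqintM U V : sqint U -> sqint V ->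
  P.-integrable setT (EFin \o (fun t => U t * V t)).
Proof.
move=> [mU iU] [mV iV]; have := integrableD measurableT iU iV.
apply: le_integrable => //.
  by apply/measurable_EFinP; exact: measurable_funM.
move=> t _ /=; rewrite lee_fin [leRHS]ger0_norm; last first.
  by rewrite addr_ge0 ?sqr_ge0.
have := sqr_ge0 (U t + V t); have := sqr_ge0 (U t - V t).
by rewrite ler_norml !expr2 => *; apply/andP; split; nra.
Qed.

Lemma sqint_integrable U : sqint U -> P.-integrable setT (EFin \o U).
Proof.
move=> sU; have := sqintM sU (sqint_bmeas (bmeas_cst _ 1)).
by apply: eq_integrable => // t _ /=; rewrite mulr1.
Qed.

Lemma sqintD U V : sqint U -> sqint V -> sqint (fun t => U t + V t).
Proof.
move=> sU sV; split; first exact: measurable_funD sU.1 sV.1.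
have h := integrableZl measurableT 2 (sqintM sU sV).
have := integrableD measurableT (integrableD measurableT sU.2 sV.2) h.
by apply: eq_integrable => // t _ /=; rewrite -EFinM -!EFinD; congr _%:E; ring.
Qed.

Lemma sqint_sum (I : Type) (s : seq I) (U : I -> T -> R) :
  (forall i, sqint (U i)) -> sqint (fun t => \sum_(i <- s) U i t).
Proof.
move=> sU; elim: s => [|i s IHs].
  rewrite (_ : (fun _ => _) = fun=> 0); last by apply/funext => t; rewrite big_nil.
  exact/sqint_bmeas/bmeas_cst.
rewrite (_ : (fun _ => _) = fun t => U i t + \sum_(i <- s) U i t).
  exact: sqintD.
by apply/funext => t; rewrite big_cons.
Qed.

End clip_integral.

(** * Positivity of the rescaled covariances for square integrable transforms *)

Section cov_psd.
Context d (T : measurableType d) (R : realType) (P : probability T R).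
Variable Y : nat -> {RV P >-> R}.
Hypothesis Y_iid : iid Y.
Variables (n : nat) (m : 'I_n -> nat) (f : 'I_n -> R -> R).
Hypotheses (m_ge1 : forall j, (1 <= m j)%N).
Hypothesis mf : forall j, measurable_fun setT (f j).

Let U j t := f j (partial_sum Y (m j) t).

Hypothesis sU : forall j, sqint P (U j).
Hypothesis U_centered : forall j, \int[P]_t U j t = 0.

(** Clipping spoils centring, so clipped transforms are recentred by [c M j]. The bounded case gives
    a nonnegative form [q M], and dominated convergence identifies its limit because [c n%:R j]
    tends to 0. *)
Lemma cov_psd :
  psd (fun j k => (\int[P]_t (U j t * U k t)) / (minn (m j) (m k))%:R).
Proof.
move=> a.
pose c M j := \int[P]_t clip M (U j t).
pose e M j k := \int[P]_t (clip M (U j t) * clip M (U k t)).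
pose q M := \sum_j \sum_k
  (e M j k - c M j * c M k) / (minn (m j) (m k))%:R * a j * a k.
have q_ge0 M : 0 <= M -> 0 <= q M.
  move=> M0.
  have bU j : bmeas (fun t => clip M (U j t)).
    split; last by exists M => t; exact: clip_le.
    apply: measurableT_comp; first exact: measurable_clip.
    exact: (sU j).1.
  (* The coefficient [a j] is absorbed into the transform, so that [bounded_cov_ge0] directly yields
     the value of the form at [a]. *)
  pose g j x := a j * (clip M (f j x) - c M j).
  have bg j : bmeas (g j).
    apply: bmeasM; first exact: bmeas_cst.
    apply: bmeasB; last exact: bmeas_cst.
    split; last by exists M => t; exact: clip_le.
    by apply: measurableT_comp => //; exact: measurable_clip.
  have bUc j : bmeas (fun t => clip M (U j t) - c M j).
    by apply: bmeasB => //; exact: bmeas_cst.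
  have g0 j : \int[P]_t g j (partial_sum Y (m j) t) = 0.
    rewrite RintZ; last exact: bUc.
    rewrite RintB; [|exact: bU|exact: bmeas_cst].
    by rewrite Rint_cst subrr mulr0.
  have := bounded_cov_ge0 Y_iid m_ge1 bg g0; congr (_ <= _).
  apply: eq_bigr => j _; apply: eq_bigr => k _.
  suff -> : \int[P]_t (g j (partial_sum Y (m j) t) * g k (partial_sum Y (m k) t)) =
    a j * a k * (e M j k - c M j * c M k) by ring.
  transitivity (\int[P]_t (a j * a k *
      ((clip M (U j t) - c M j) * (clip M (U k t) - c M k)))).
    by apply: eq_Rintegral => t _; rewrite /g; ring.
  rewrite RintZ; last exact: bmeasM.
  congr (_ * _).
  transitivity (\int[P]_t (clip M (U j t) * clip M (U k t) -
      (c M j * clip M (U k t) + (c M k * clip M (U j t) - c M j * c M k)))).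
    by apply: eq_Rintegral => t _; ring.
  have bZ x i : bmeas (fun t => x * clip M (U i t)).
    by apply: bmeasM => //; exact: bmeas_cst.
  rewrite RintB ?RintD ?RintB ?RintZ ?Rint_cst//.
  - by rewrite -/(c M j) -/(c M k) -/(e M j k); ring.
  - exact: bmeas_cst.
  - by apply: bmeasB => //; exact: bmeas_cst.
  - exact: bmeasM.
  - by apply: bmeasD => //; apply: bmeasB => //; exact: bmeas_cst.
have cvg_c j : c n%:R j @[n --> \oo] --> 0.
  rewrite -(U_centered j); apply: Rint_clip_cvg; first exact: (sU j).1.
  exact: sqint_integrable.
have cvg_e j k : e n%:R j k @[n --> \oo] --> \int[P]_t (U j t * U k t).
  by apply: Rint_clipM_cvg; [exact: (sU j).1|exact: (sU k).1|exact: sqintM].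
have cvg_q : q n%:R @[n --> \oo] -->
    qform (fun j k => (\int[P]_t (U j t * U k t)) / (minn (m j) (m k))%:R) a.
  apply: cvg_big => [|j _]; first exact: add_continuous.
  apply: cvg_big => [|k _]; first exact: add_continuous.
  apply: cvgMl; apply: cvgMl; apply: cvgMl.
  rewrite -[X in _ --> X]subr0 -[X in _ - X](mulr0 0).
  by apply: cvgB => //; exact: cvgM.
rewrite -(cvg_lim _ cvg_q)//; apply: limr_ge.
  by apply/cvg_ex; eexists; exact: cvg_q.
by near=> i; apply: q_ge0.
Unshelve. all: by end_near. Qed.

End cov_psd.

(** * Correlations of admissible transforms *)

Section correlation.
Context d (T : measurableType d) (R : realType) (P : probability T R).
Implicit Types U V : T -> R.

Definition rcov U V : R :=
  \int[P]_t ((U t - \int[P]_s U s) * (V t - \int[P]_s V s)).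

Lemma correlationE U V : correlation P U V =
  rcov U V / (Num.sqrt (rcov U U) * Num.sqrt (rcov V V)).
Proof.
have covE U' V' : fine (covariance P U' V') = rcov U' V'.
  by rewrite covariance.unlock /rcov expectation.unlock.
by rewrite /correlation /variance !covE.
Qed.

Lemma rcov_centered U V : \int[P]_t U t = 0 -> \int[P]_t V t = 0 ->
  rcov U V = \int[P]_t (U t * V t).
Proof.
by move=> U0 V0; rewrite /rcov U0 V0; apply: eq_Rintegral => t _; rewrite !subr0.
Qed.

End correlation.

Section overlap.
Variables (R : realType) (n : nat) (m : 'I_n -> nat).
Hypothesis m_ge1 : forall j, (1 <= m j)%N.

Lemma overlap_mxC j k : overlap_mx R m j k = overlap_mx R m k j.
Proof. by rewrite !mxE minnC [(m j)%:R * _]mulrC. Qed.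

(** Dividing by the minimum and rescaling rows and columns by sqrt(m_j / c_jj) extracts the overlap
    matrix as a Schur factor. *)
Lemma overlap_mxE (c : 'I_n -> 'I_n -> R) j k : 0 < c j j -> 0 < c k k ->
  c j k / (Num.sqrt (c j j) * Num.sqrt (c k k)) =
  overlap_mx R m j k * (c j k / (minn (m j) (m k))%:R *
    (Num.sqrt (m j)%:R / Num.sqrt (c j j)) *
    (Num.sqrt (m k)%:R / Num.sqrt (c k k))).
Proof.
move=> cj ck; rewrite mxE sqrtrM//.
have s0 (x : R) : 0 < x -> Num.sqrt x != 0 by move=> x0; rewrite gt_eqF// sqrtr_gt0.
have mj : Num.sqrt (m j)%:R != 0 :> R by rewrite s0// ltr0n.
have mk : Num.sqrt (m k)%:R != 0 :> R by rewrite s0// ltr0n.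
have mjk : (minn (m j) (m k))%:R != 0 :> R.
  by rewrite pnatr_eq0 -lt0n leq_min !m_ge1.
by field; rewrite mj mk mjk !s0.
Qed.

Lemma overlap_mx_of_cov (c : 'I_n -> 'I_n -> R) (w : R) j k : 0 < w ->
  (forall j k, c j k = (minn (m j) (m k))%:R * w) ->
  c j k / (Num.sqrt (c j j) * Num.sqrt (c k k)) = overlap_mx R m j k.
Proof.
move=> w0 cE; rewrite !cE !minnn mxE -sqrtrM ?mulr_ge0 ?ler0n ?(ltW w0)//.
rewrite [X in Num.sqrt X]mulrACA -expr2 [in LHS]sqrtrM ?mulr_ge0//.
by rewrite sqrtr_sqr gtr0_norm// invfM mulrACA mulfV ?mulr1// gt_eqF.
Qed.

End overlap.

(** * Admissible correlations are Schur multiples of the overlap matrix: upper bound *)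

Section upper_bound.
Context d (T : measurableType d) (R : realType) (P : probability T R).
Variables (Y : nat -> {RV P >-> R}) (n : nat) (m : 'I_n -> nat).
Hypotheses (Y_iid : iid Y) (m_ge1 : forall j, (1 <= m j)%N).

Let X j := partial_sum Y (m j).

Lemma admissibleP (f : 'I_n -> {mfun R >-> R}) : admissible P X f <->
  forall j, [/\ \int[P]_t transform X f j t = 0,
                sqint P (transform X f j) &
                0 < \int[P]_t transform X f j t ^+ 2].
Proof.
have mU j : measurable_fun setT (transform X f j).
  by apply: measurableT_comp => //; exact: measurable_partial_sum.
have E2 j : ('E_P[(transform X f j ^+ 2)%R] =
    \int[P]_t (transform X f j t ^+ 2)%:E)%E.
  by rewrite expectation.unlock.
have int2_ge0 j : (0 <= \int[P]_t (transform X f j t ^+ 2)%:E)%E.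
  by apply: integral_ge0 => t _; rewrite lee_fin sqr_ge0.
split=> + j => /(_ j) [].
  rewrite E2 => E0 pos fin.
  have sq : sqint P (transform X f j).
    split=> //; apply/integrableP; split.
      by apply/measurable_EFinP; exact: measurable_funX.
    by under eq_integral do rewrite /= ger0_norm ?sqr_ge0//.
  split=> //; first by rewrite /Rintegral; move: E0; rewrite expectation.unlock => ->.
  by rewrite fine_gt0// pos fin.
move=> U0 sU pos; have iU := sqint_integrable sU.
have fin2 := integrable_fin_num measurableT sU.2.
rewrite E2; split.
- rewrite expectation.unlock -[LHS]fineK; last exact: integrable_fin_num.
  by congr _%:E.
- by rewrite -[X in (_ < X)%E]fineK// lte_fin.
- by rewrite ltey_eq fin2.
Qed.

(** [G] is the matrix of [cov_psd] rescaled on both sides by [s], which preserves positivity and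
    normalises the diagonal. *)
Lemma admissible_correlation (f : 'I_n -> {mfun R >-> R}) :
  admissible P X f ->
  exists G : 'I_n -> 'I_n -> R, [/\ psd G, forall j, G j j = 1 &
    forall j k, correlation_mx P (transform X f) j k = overlap_mx R m j k * G j k].
Proof.
move=> /admissibleP fP.
pose U j := transform X f j; pose c j k := \int[P]_t (U j t * U k t).
have U0 j : \int[P]_t U j t = 0 by case: (fP j).
have sU j : sqint P (U j) by case: (fP j).
have cjj j : 0 < c j j.
  by have [_ _] := fP j; congr (_ < _); apply: eq_Rintegral => t _; rewrite expr2.
pose s j := Num.sqrt (m j)%:R / Num.sqrt (c j j).
exists (fun j k => c j k / (minn (m j) (m k))%:R * s j * s k); split=> [a|j|j k].
- have mf j : measurable_fun setT (f j) by exact: measurable_funPT.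
  have := cov_psd Y_iid m_ge1 mf sU U0 (fun j => s j * a j); congr (_ <= _).
  apply: eq_bigr => j _; apply: eq_bigr => k _.
  rewrite -[LHS]/(c j k / (minn (m j) (m k))%:R * (s j * a j) * (s k * a k)).
  by ring.
- rewrite minnn -mulrA -expr2 expr_div_n !sqr_sqrtr ?ler0n ?ltW//.
  have mj : (m j)%:R != 0 :> R by rewrite pnatr_eq0 -lt0n.
  by field; rewrite mj gt_eqF.
- by rewrite mxE correlationE !rcov_centered// -!/(c _ _) (overlap_mxE m_ge1).
Qed.

Variable nu : set 'I_n -> \bar R.
Hypothesis nu_ge0 : forall A, (0 <= nu A)%E.
Variable W : 'M[R]_n.
Hypothesis W_sym : forall j k, W j k = W k j.

Lemma rhoNL_max_le : (rhoNL_max P X nu W <= form_max nu W (overlap_mx R m))%E.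
Proof.
apply: ge_ereal_sup => _ [f /admissible_correlation[G [pG G1 GE]] <-].
exact: (form_max_schur_le nu_ge0 W_sym (overlap_mxC _ _) pG G1 GE).
Qed.

Lemma rhoNL_min_ge : (form_min nu W (overlap_mx R m) <= rhoNL_min P X nu W)%E.
Proof.
apply: le_ereal_inf_tmp => _ [f /admissible_correlation[G [pG G1 GE]] <-].
exact: (form_min_schur_ge nu_ge0 W_sym (overlap_mxC _ _) pG G1 GE).
Qed.

End upper_bound.

(** * Sums of square integrable iid variables *)

Lemma Rintegral_sum d (T : measurableType d) (R : realType)
    (P : probability T R) (I : Type) (s : seq I) (f : I -> T -> R) :
  (forall i, P.-integrable setT (EFin \o f i)) ->
  \int[P]_t (\sum_(i <- s) f i t) = \sum_(i <- s) \int[P]_t f i t.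
Proof.
move=> fi; have isum s' : P.-integrable setT (EFin \o (fun t => \sum_(i <- s') f i t)).
  have := integrable_sum measurableT s' (fun i (_ : true) => fi i).
  by apply: eq_integrable => // t _ /=; rewrite sumEFin.
elim: s => [|i s IHs].
  by rewrite big_nil; under eq_Rintegral do rewrite big_nil; rewrite Rint_cst.
rewrite big_cons -IHs -RintegralD//.
by apply: eq_Rintegral => t _; rewrite big_cons.
Qed.

Section iid_square_integrable.
Context d (T : measurableType d) (R : realType) (P : probability T R).
Variable Y : nat -> {RV P >-> R}.
Hypothesis Y_iid : iid Y.
Variable h : R -> R.
Hypothesis mh : measurable_fun setT h.
Hypothesis sh : sqint P (h \o Y 0%N).

Let Rint_sqr_iid i :
  (\int[P]_t (h (Y i t) ^+ 2)%:E = \int[P]_t (h (Y 0%N t) ^+ 2)%:E)%E.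
Proof.
have mh2 : measurable_fun setT (fun y => (h y ^+ 2)%:E).
  by apply/measurable_EFinP; exact: measurable_funX.
have h2_ge0 y : (0 <= (h y ^+ 2)%:E)%E by rewrite lee_fin sqr_ge0.
rewrite -(ge0_integral_distribution (Y i) mh2 h2_ge0).
rewrite -(ge0_integral_distribution (Y 0%N) mh2 h2_ge0).
by apply: eq_measure_integral => A mA _; exact: Y_iid.2.
Qed.

Lemma sqint_iid i : sqint P (h \o Y i).
Proof.
have mhY : measurable_fun setT (h \o Y i) by exact: measurableT_comp.
split=> //; apply/integrableP; split.
  by apply/measurable_EFinP; exact: measurable_funX.
under eq_integral do rewrite /= ger0_norm ?sqr_ge0//.
rewrite Rint_sqr_iid; have /integrableP[_] := sh.2.
by under eq_integral do rewrite /= ger0_norm ?sqr_ge0//.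
Qed.

Lemma Rint_iid_sqr i : \int[P]_t (h (Y i t) ^+ 2) = \int[P]_t (h (Y 0%N t) ^+ 2).
Proof. by congr fine; exact: Rint_sqr_iid. Qed.

(** Equality of laws is used on clipped values, then the clipping level tends to infinity. *)
Lemma Rint_iid_sqint i : \int[P]_t h (Y i t) = \int[P]_t h (Y 0%N t).
Proof.
have cvgh k := Rint_clip_cvg (sqint_iid k).1 (sqint_integrable (sqint_iid k)).
have clipE : (fun n => \int[P]_t clip n%:R (h (Y i t))) =
             (fun n => \int[P]_t clip n%:R (h (Y 0%N t))).
  apply/funext => n; have bc := bmeas_comp mh (bmeas_clip (ler0n R n)).
  by rewrite (Rint_iid Y_iid i bc) (Rint_iid Y_iid 0 bc).
have := cvgh i; rewrite [X in X @ _]clipE => cvgi.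
exact: (cvg_unique _ cvgi (cvgh 0%N)).
Qed.

(** [Rint_independent] covers bounded functions, so both factors are clipped at the same level and
    the limit is taken on each side. *)
Lemma Rint_iid_pair i k : i != k ->
  \int[P]_t (h (Y i t) * h (Y k t)) = (\int[P]_t h (Y 0%N t)) ^+ 2.
Proof.
move=> ik.
have cvg_pair := Rint_clipM_cvg (sqint_iid i).1 (sqint_iid k).1
  (sqintM (sqint_iid i) (sqint_iid k)).
have bc n : bmeas (fun y => clip n%:R (h y)).
  exact: (bmeas_comp mh (bmeas_clip (ler0n R n))).
have pair_indep A B : measurable A -> measurable B ->
    P (Y i @^-1` A `&` Y k @^-1` B) = (P (Y i @^-1` A) * P (Y k @^-1` B))%E.
  move=> mA mB; pose C l := if l == i then A else B.
  have mC l : measurable (C l) by rewrite /C; case: ifP.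
  have := Y_iid.1 [:: i; k] C; rewrite /= inE ik => /(_ isT mC).
  rewrite !big_cons big_nil mule1 /C eqxx eq_sym (negPf ik) => <-.
  congr (P _); apply/seteqP; split=> [t [At Bt] l /=|t h1].
    by rewrite !inE => /orP[] /eqP ->; rewrite ?eqxx // eq_sym (negPf ik).
  have := h1 i; have := h1 k; rewrite /= !inE !eqxx orbT eq_sym (negPf ik).
  by move=> /(_ isT) ? /(_ isT) ?.
have E n : \int[P]_t (clip n%:R ((h \o Y i) t) * clip n%:R ((h \o Y k) t)) =
    (\int[P]_t clip n%:R ((h \o Y 0%N) t)) ^+ 2.
  pose F (z : R * R) := clip n%:R (h z.1) * clip n%:R (h z.2).
  have bF : bmeas F.
    apply: bmeasM; first exact: (bmeas_comp measurable_fst (bc n)).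
    exact: (bmeas_comp measurable_snd (bc n)).
  rewrite (Rint_independent pair_indep bF) /F /=.
  under eq_Rintegral do rewrite RintZ// (Rint_same_distribution Y_iid)// mulrC.
  rewrite RintZ; last exact: (bmeas_comp (measurable_funPT (Y i)) (bc n)).
  by rewrite (Rint_iid Y_iid i (bc n)) (Rint_iid Y_iid 0 (bc n)) expr2.
have cvg0 := Rint_clip_cvg (sqint_iid 0).1 (sqint_integrable (sqint_iid 0)).
apply: (cvg_unique _ cvg_pair); first exact: norm_hausdorff.
rewrite (funext E) expr2; exact: cvgM.
Qed.

Hypothesis h0 : \int[P]_t h (Y 0%N t) = 0.

Let Z j t := \sum_(1 <= i < j.+1) h (Y i t).

Lemma sqint_sum_iid j : sqint P (Z j).
Proof. by apply: sqint_sum => i; exact: sqint_iid. Qed.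

Lemma Rint_sum_iid j : \int[P]_t Z j t = 0.
Proof.
rewrite Rintegral_sum => [|i]; last exact/sqint_integrable/sqint_iid.
by apply: big1 => i _; rewrite Rint_iid_sqint.
Qed.

(** Off-diagonal products have mean zero, and the two ranges share [minn j k] indices. The general
    [h] serves both the centred summands and the clipped, centred ones. *)
Lemma Rint_sum_iidM j k :
  \int[P]_t (Z j t * Z k t) = (minn j k)%:R * \int[P]_t h (Y 0%N t) ^+ 2.
Proof.
wlog jk : j k / (j <= k)%N.
  move=> wl; have [jk|/ltnW kj] := leqP j k.
    by rewrite wl// (minn_idPl jk).
  transitivity (\int[P]_t (Z k t * Z j t)); last by rewrite wl// (minn_idPl kj).
  by apply: eq_Rintegral => t _; rewrite mulrC.
rewrite (minn_idPl jk).
have ihh i l : P.-integrable setT (EFin \o (fun t => h (Y i t) * h (Y l t))).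
  exact: (sqintM (sqint_iid i) (sqint_iid l)).
transitivity (\int[P]_t \sum_(1 <= i < j.+1) \sum_(1 <= l < k.+1)
    (h (Y i t) * h (Y l t))).
  apply: eq_Rintegral => t _; rewrite /Z mulr_suml; apply: eq_bigr => i _.
  by rewrite mulr_sumr.
rewrite Rintegral_sum => [|i]; last first.
  have := integrable_sum measurableT (index_iota 1 k.+1) (fun l (_ : true) => ihh i l).
  by apply: eq_integrable => // t _ /=; rewrite sumEFin.
rewrite (eq_big_seq (fun=> \int[P]_t h (Y 0%N t) ^+ 2)) => [|i].
  by rewrite sumr_const_nat subSS subn0 mulr_natl.
rewrite mem_index_iota ltnS => /andP[i1 ij].
rewrite Rintegral_sum; last exact: ihh.
rewrite (bigD1_seq i) ?iota_uniq//=; last first.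
  by rewrite mem_index_iota i1 ltnS (leq_trans ij).
rewrite big1 ?addr0 => [|l li].
  by rewrite -(Rint_iid_sqr i).
by rewrite Rint_iid_pair 1?eq_sym// h0 expr0n.
Qed.

End iid_square_integrable.

(** * Linear transforms *)

(** A vanishing integral would force the variable to equal [c] almost surely, that is, to be
    degenerate. *)
Lemma non_degenerate_sqr_gt0 d (T : measurableType d) (R : realType)
    (P : probability T R) (X : {RV P >-> R}) (c : R) :
  non_degenerate X -> sqint P (fun t => X t - c) ->
  0 < \int[P]_t (X t - c) ^+ 2.
Proof.
move=> ndX [mU iU]; rewrite lt_neqAle Rintegral_ge0 ?andbT => [|t _]; last first.
  exact: sqr_ge0.
apply/negP => /eqP/esym I0; apply: (ndX c).
have mU2 : measurable_fun setT (fun t => ((X t - c) ^+ 2)%:E).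
  by apply/measurable_EFinP; exact: measurable_funX.
have : (\int[P]_t `|((X t - c) ^+ 2)%:E| = 0)%E.
  under eq_integral do rewrite /= ger0_norm ?sqr_ge0//.
  rewrite -[LHS]fineK; last exact: (integrable_fin_num _ iU).
  by rewrite -[RHS]/(0%:E) -I0.
move=> /(ae_eq_integral_abs P measurableT mU2) ae0.
rewrite /distribution /pushforward.
have mX : measurable (X @^-1` [set c]) by exact: measurable_funPTI.
rewrite -(setCK (X @^-1` [set c])) probability_setC; last exact: measurableC.
have [N [mN N0 sub]] := ae0.
rewrite (_ : P _ = 0)%E ?sube0//; apply/eqP; rewrite eq_le measure_ge0 andbT.
rewrite -N0; apply: le_measure; rewrite ?inE//; first exact: measurableC.
apply: subset_trans sub => t /= Xc h; apply: Xc.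
have := h I => -[] /eqP; rewrite sqrf_eq0 subr_eq0 => /eqP //.
Qed.

Section finite_second_moment.
Context d (T : measurableType d) (R : realType) (P : probability T R).
Variables (Y : nat -> {RV P >-> R}) (n : nat) (m : 'I_n -> nat).
Hypotheses (Y_iid : iid Y) (Y_nd : non_degenerate (Y 0%N)).
Hypothesis m_ge1 : forall j, (1 <= m j)%N.
Hypothesis sY : sqint P (Y 0%N).

Let X j := partial_sum Y (m j).
Let e := \int[P]_t Y 0%N t.
Let h (y : R) := y - e.
Let v := \int[P]_t h (Y 0%N t) ^+ 2.

Let mh : measurable_fun setT h.
Proof. by apply: measurable_funB => //; exact: measurable_cst. Qed.

Let sh : sqint P (h \o Y 0%N).
Proof. by apply: (sqintD sY (sqint_bmeas P (bmeas_cst T (- e)))). Qed.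

Let h0 : \int[P]_t h (Y 0%N t) = 0.
Proof.
rewrite RintegralB//; last 2 first.
- exact: sqint_integrable.
- exact: (bmeas_integrable P (bmeas_cst T e)).
by rewrite Rint_cst subrr.
Qed.

Let v_gt0 : 0 < v. Proof. exact: non_degenerate_sqr_gt0. Qed.

Let Z j t := \sum_(1 <= i < j.+1) h (Y i t).

Let XE j t : X j t = Z (m j) t + (m j)%:R * e.
Proof. by rewrite /Z sumrB sumr_const_nat subSS subn0 mulr_natl subrK. Qed.

Let sZ j : sqint P (Z j). Proof. exact: sqint_sum_iid. Qed.

Let X_mean j : \int[P]_t X j t = (m j)%:R * e.
Proof.
under eq_Rintegral do rewrite XE.
rewrite RintegralD//; last 2 first.
- exact/sqint_integrable/sZ.
- exact: (bmeas_integrable P (bmeas_cst T _)).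
by rewrite Rint_cst (Rint_sum_iid Y_iid mh sh h0) add0r.
Qed.

Let rcovX j k : rcov P (X j) (X k) = (minn (m j) (m k))%:R * v.
Proof.
rewrite -(Rint_sum_iidM Y_iid mh sh h0); apply: eq_Rintegral => t _.
by rewrite !X_mean !XE !addrK.
Qed.

Lemma correlation_partial_sum : correlation_mx P X = overlap_mx R m.
Proof.
apply/matrixP => j k; rewrite [LHS]mxE correlationE.
exact: (overlap_mx_of_cov (c := fun j k => rcov P (X j) (X k)) _ _ v_gt0 rcovX).
Qed.

Lemma linear_transform_overlap : exists2 f : 'I_n -> {mfun R >-> R},
  admissible P X f & correlation_mx P (transform X f) = overlap_mx R m.
Proof.
have mf j : measurable_fun setT (fun x : R => x - (m j)%:R * e).
  by apply: measurable_funB => //; exact: measurable_cst.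
pose f j : {mfun R >-> R} := HB.pack (fun x : R => x - (m j)%:R * e)
  (isMeasurableFun.Build _ _ _ _ _ (mf j)).
have fE j : transform X f j = Z (m j).
  by apply/funext => t; rewrite /transform /= XE addrK.
have Z0 j : \int[P]_t Z j t = 0 by exact: Rint_sum_iid.
have ZZ j k := Rint_sum_iidM Y_iid mh sh h0 j k.
exists f.
  apply/(admissibleP Y m) => j; rewrite fE; split=> //.
  under eq_Rintegral do rewrite expr2.
  by rewrite ZZ minnn mulr_gt0// ltr0n.
apply/matrixP => j k; rewrite [LHS]mxE correlationE !fE.
apply: (overlap_mx_of_cov (c := fun j k => rcov P (Z (m j)) (Z (m k))) _ _ v_gt0).
by move=> a b; rewrite rcov_centered ?ZZ ?Z0.
Qed.

End finite_second_moment.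

(** * Truncated sums *)

Section clip_sums.
Variable R : realType.
Implicit Types A M a b x : R.

Lemma clip0 M : 0 <= M -> clip M 0 = 0.
Proof. by move=> M0; rewrite clip_id// normr0. Qed.

Lemma clip_normE M x : 0 <= M -> `|clip M x| = Num.min `|x| M.
Proof.
move=> M0; have [xM|/ltW Mx] := leP `|x| M; first by rewrite clip_id.
rewrite /clip; have [x0|x0] := leP 0 x.
  move: Mx; rewrite ger0_norm// => Mx; rewrite (min_r Mx) max_r ?ger0_norm//; lra.
move: Mx; rewrite ltr0_norm// => Mx; rewrite min_l; last lra.
by rewrite max_l ?normrN ?ger0_norm//; lra.
Qed.

(** For small [b] this follows from the Lipschitz bound; for large [b] both sides are compared with
    twice [M]. *)
Lemma clipD_sub_le M a b : 0 <= M -> `|clip M (a + b) - clip M a| <= 2 * `|clip M b|.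
Proof.
move=> M0; have [bM|Mb] := leP `|b| M.
  rewrite (clip_id bM); have := clip_lipschitz M (a + b) a.
  by rewrite addrAC subrr add0r; have := normr_ge0 b; lra.
rewrite [X in _ <= 2 * X]clip_normE// (min_r (ltW Mb)).
rewrite (le_trans (ler_normB _ _))//.
by have := clip_le (a + b) M0; have := clip_le a M0; lra.
Qed.

(* A bounded continuous majorant of the indicator of [A < `|x|]. *)
Definition tail A x := clip 1 (`|x| / A).

Lemma tail_ge0 A x : 0 < A -> 0 <= tail A x.
Proof.
move=> A0; rewrite /tail /clip le_max; apply/orP; right.
by rewrite le_min ler01 andbT divr_ge0// ltW.
Qed.

Lemma tail_le1 A x : tail A x <= 1.
Proof. by rewrite (le_trans (ler_norm _))// clip_le. Qed.

Lemma tail1 A x : 0 < A -> A <= `|x| -> tail A x = 1.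
Proof.
move=> A0 Ax; rewrite /tail /clip min_r; first by rewrite max_r// lerN10_1//; lra.
by rewrite ler_pdivlMr// mul1r.
Qed.

Lemma bmeas_tail A : bmeas (tail A).
Proof.
apply: (bmeas_comp (h := fun x => `|x| / A)); last exact: bmeas_clip.
by apply: measurable_funM; [exact: normr_measurable|exact: measurable_cst].
Qed.

(** If [a] is at most [A] in absolute value, the error is at most [2 * A] by the Lipschitz property.
    Otherwise it is at most three times the clipped [b], and [tail A a] is 1. The last product
    factorises in the mean when a and b are independent. *)
Lemma clipD_sqr_le M A a b : 0 <= M -> 0 < A ->
  (clip M (a + b) - clip M a - clip M b) ^+ 2 <=
  4 * A ^+ 2 + 9 * (tail A a * clip M b ^+ 2).
Proof.
move=> M0 A0; have [aA|/ltW Aa] := leP `|a| A.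
  have t0 : 0 <= tail A a * clip M b ^+ 2 by rewrite mulr_ge0 ?sqr_ge0 ?tail_ge0.
  suff : (clip M (a + b) - clip M a - clip M b) ^+ 2 <= 4 * A ^+ 2 by lra.
  have -> : 4 * A ^+ 2 = (2 * A) ^+ 2 by ring.
  rewrite -real_normK ?num_real// ler_sqr ?nnegrE ?mulr_ge0 ?(ltW A0)//.
  have h1 := clip_lipschitz M (a + b) b; rewrite addrK in h1.
  have h2 := clip_norm_le a M0.
  have h3 := ler_normB (clip M (a + b) - clip M b) (clip M a).
  rewrite addrAC; lra.
rewrite tail1// mul1r.
have A2 : 0 <= 4 * A ^+ 2 by rewrite mulr_ge0 ?sqr_ge0.
suff : (clip M (a + b) - clip M a - clip M b) ^+ 2 <= 9 * clip M b ^+ 2 by lra.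
have -> : 9 * clip M b ^+ 2 = (3 * `|clip M b|) ^+ 2.
  by rewrite exprMn real_normK ?num_real//; ring.
rewrite -real_normK ?num_real// ler_sqr ?nnegrE ?mulr_ge0//.
have := clipD_sub_le a b M0; have := ler_normB (clip M (a + b) - clip M a) (clip M b).
lra.
Qed.

End clip_sums.

Section bounded_integrals.
Context d (T : measurableType d) (R : realType) (P : probability T R).
Implicit Types U V : T -> R.

Lemma Rint_tail_cvg U : measurable_fun setT U ->
  \int[P]_t tail k.+1%:R (U t) @[k --> \oo] --> 0.
Proof.
move=> mU; have -> : 0 = \int[P]_t 0 :> R by rewrite Rint_cst.
apply: fine_cvg; rewrite -[X in _ --> X]Rint_EFin; last exact: bmeas_cst.
apply: (@dominated_cvg _ _ _ P _ measurableT
  (fun k t => (tail k.+1%:R (U t))%:E) (fun=> 0%:E) (fun=> 1%:E)) => //.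
- move=> k; apply/measurable_EFinP; apply: measurableT_comp => //.
  exact: (bmeas_tail _).1.
- move=> t _; apply: cvg_EFin; first by near=> k.
  have le_tail k : tail k.+1%:R (U t) <= `|U t| * k.+1%:R^-1.
    rewrite /tail /clip ge_max ge_min lexx orTb andbT.
    by rewrite (@le_trans _ _ 0) ?oppr_le0// divr_ge0.
  apply: (@squeeze_cvgr _ _ _ _ (fun=> 0) (fun k => `|U t| * k.+1%:R^-1)).
  + by near=> k; rewrite le_tail tail_ge0.
  + exact: cvg_cst.
  + rewrite -(mulr0 `|U t|); apply: cvgM; first exact: cvg_cst.
    exact: cvg_harmonic.
- exact: (bmeas_integrable P (bmeas_cst T 1)).
- move=> k t _ /=; rewrite lee_fin ger0_norm ?tail_le1//.
  exact: tail_ge0.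
Unshelve. all: by end_near. Qed.

Lemma Rint_cauchy_schwarz U V : bmeas U -> bmeas V ->
  (\int[P]_t (U t * V t)) ^+ 2 <= \int[P]_t U t ^+ 2 * \int[P]_t V t ^+ 2.
Proof.
move=> bU bV; set a := \int[P]_t U t ^+ 2; set c := \int[P]_t V t ^+ 2.
set b := \int[P]_t _.
have q x y : 0 <= x ^+ 2 * a + (2 * x * y * b + y ^+ 2 * c).
  have -> : x ^+ 2 * a + (2 * x * y * b + y ^+ 2 * c) =
      \int[P]_t (x * U t + y * V t) ^+ 2.
    transitivity (\int[P]_t (x ^+ 2 * U t ^+ 2 + (2 * x * y * (U t * V t) +
       y ^+ 2 * V t ^+ 2))); last by apply: eq_Rintegral => t _; ring.
    have bZ k F : bmeas F -> bmeas (fun t : T => k * F t).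
      by move=> bF; apply: bmeasM => //; exact: bmeas_cst.
    have bU2 := bmeasX bU; have bV2 := bmeasX bV; have bUV := bmeasM bU bV.
    by rewrite !RintD ?RintZ//; do ?[apply: bmeasD]; exact: bZ.
  by apply: Rintegral_ge0 => t _; exact: sqr_ge0.
have a0 : 0 <= a by apply: Rintegral_ge0 => t _; exact: sqr_ge0.
have [aE|a_neq0] := eqVneq a 0; last first.
  have ap : 0 < a by rewrite lt_neqAle eq_sym a_neq0.
  have := q (- b) a; rewrite -subr_ge0.
  have -> : (- b) ^+ 2 * a + (2 * - b * a * b + a ^+ 2 * c) = a * (a * c - b ^+ 2).
    by ring.
  by rewrite pmulr_rge0.
(* When [a] is zero, the point (-(c + 1), b) gives the form the value -(c + 2) b^2, which forces [b]
   to vanish. *)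
have := q (- (c + 1) * b) (b ^+ 2); have := q (- (c + 1)) b; rewrite aE => h1 _.
have c0 : 0 <= c by apply: Rintegral_ge0 => t _; exact: sqr_ge0.
have := sqr_ge0 b; have : 0 <= c * b ^+ 2 by rewrite mulr_ge0 ?sqr_ge0.
rewrite mul0r; nra.
Qed.

End bounded_integrals.

Section negligible.
Variables (R : realType) (w : nat -> R).

(* When [w] tends to infinity, this bounds [a] above by [o(w)]. *)
Definition negl (a : nat -> R) :=
  forall e, 0 < e -> exists C, forall n, a n <= C + e * w n.

Lemma neglD a b : negl a -> negl b -> negl (fun n => a n + b n).
Proof.
move=> na nb e e0; have e2 : 0 < e / 2 by rewrite divr_gt0.
have [C aC] := na _ e2; have [D bD] := nb _ e2; exists (C + D) => n.
by have := aC n; have := bD n; lra.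
Qed.

Lemma neglZ c a : 0 < c -> negl a -> negl (fun n => c * a n).
Proof.
move=> c0 na e e0; have [C aC] := na _ (divr_gt0 e0 c0); exists (c * C) => n.
have : c * a n <= c * (C + e / c * w n) by rewrite ler_pM2l.
by have -> : c * (C + e / c * w n) = c * C + e * w n by field; rewrite gt_eqF.
Qed.

Lemma negl_le a b : (forall n, a n <= b n) -> negl b -> negl a.
Proof.
by move=> ab nb e /nb[C bC]; exists C => n; exact: le_trans (bC n).
Qed.

Hypothesis w_cvg : w @ \oo --> +oo.

Lemma negl_cvg0 a : (forall n, 0 <= a n) -> negl a -> a n / w n @[n --> \oo] --> 0.
Proof.
move=> a0 na; apply/cvgrPdist_le => e e0.
have [C aC] := na _ (divr_gt0 e0 (ltr0n R 2)).
near=> n.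
have w1 : 1 <= w n by near: n; exact: cvgry_ge.
have wC : 2 * C / e <= w n by near: n; exact: cvgry_ge.
have wp : 0 < w n by lra.
rewrite sub0r normrN ger0_norm ?divr_ge0 ?(ltW wp)// ler_pdivrMr//.
apply: (le_trans (aC n)); move: wC; rewrite ler_pdivrMr// => wC; lra.
Unshelve. all: by end_near. Qed.

End negligible.

Lemma cvg0_sqr_le (R : realType) (a b c : nat -> R) (l : R) :
  (\forall n \near \oo, a n ^+ 2 <= b n * c n) ->
  b @ \oo --> l -> c @ \oo --> 0 -> a @ \oo --> 0.
Proof.
move=> abc bl c0; have bc0 : b n * c n @[n --> \oo] --> 0.
  by rewrite -(mulr0 l); exact: cvgM.
apply/cvgrPdist_le => e e0; near=> n.
have h2 : a n ^+ 2 <= b n * c n by near: n.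
have h1 : b n * c n <= e ^+ 2.
  by near: n; apply: (cvgr_le 0) => //; rewrite exprn_gt0.
rewrite sub0r normrN -(@ler_pXn2r _ 2)// ?nnegrE ?(ltW e0)//.
by rewrite real_normK ?num_real// (le_trans h2).
Unshelve. all: by end_near. Qed.

(** * Truncated transforms under an infinite second moment *)

Lemma div_sqrt_scale (R : rcfType) (a b c w : R) : 0 <= b -> 0 <= c -> 0 < w ->
  a / w / (Num.sqrt (b / w) * Num.sqrt (c / w)) = a / (Num.sqrt b * Num.sqrt c).
Proof.
move=> b0 c0 w0; rewrite !sqrtrM// mulrACA -expr2 sqr_sqrtr ?invr_ge0 ?(ltW w0)//.
by rewrite invfM invrK mulrACA mulVf ?mulr1// gt_eqF.
Qed.

Section infinite_second_moment.
Context d (T : measurableType d) (R : realType) (P : probability T R).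
Variables (Y : nat -> {RV P >-> R}).
Hypothesis Y_iid : iid Y.
Hypothesis Y2_oo : (\int[P]_t (Y 0%N t ^+ 2)%:E = +oo)%E.

Let X := partial_sum Y.
Let w (n : nat) := \int[P]_t clip n%:R (Y 0%N t) ^+ 2.
Let e (n : nat) := \int[P]_t clip n%:R (Y 0%N t).

Let bclip (n : nat) : bmeas (@clip R n%:R).
Proof. exact: bmeas_clip. Qed.

Let bclipY (n : nat) i : bmeas (fun t => clip n%:R (Y i t)).
Proof. exact: (bmeas_comp (measurable_funPT (Y i)) (bclip n)). Qed.

Let bclipX (n : nat) l : bmeas (fun t => clip n%:R (X l t)).
Proof. exact: (bmeas_comp (measurable_partial_sum Y l) (bclip n)). Qed.

(** Monotone convergence: the clipped squares increase to the square of [Y 0%N], whose mean is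
    infinite. *)
Let w_cvg : w @ \oo --> +oo.
Proof.
apply/cvgeryP.
have <- : (\int[P]_t limn (fun n => (clip n%:R (Y 0%N t) ^+ 2)%:E) = +oo)%E.
  rewrite -Y2_oo; apply: eq_integral => t _; apply/cvg_lim => //.
  apply: cvg_EFin; first by near=> n.
  by rewrite expr2; apply: cvgM; exact: clip_cvg.
have -> : (fun n => (w n)%:E) =
    (fun n => \int[P]_t (clip n%:R (Y 0%N t) ^+ 2)%:E)%E.
  by apply/funext => n; rewrite Rint_EFin//; exact: bmeasX.
apply: cvg_monotone_convergence => //.
- by move=> n; apply/measurable_EFinP; exact: (bmeasX (bclipY n 0)).1.
- by move=> n t _; rewrite lee_fin sqr_ge0.
- move=> t _ k l kl; rewrite lee_fin -[leLHS]real_normK ?num_real//.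
  rewrite -[leRHS]real_normK ?num_real// ler_sqr ?nnegrE// !clip_normE//.
  by rewrite le_min !ge_min lexx/= ler_nat kl orbT.
Unshelve. all: by end_near. Qed.

Let Dev (l n : nat) t := clip n%:R (X l t) - \sum_(1 <= i < l.+1) clip n%:R (Y i t).

Let bDev l n : bmeas (Dev l n).
Proof. by apply: bmeasB => //; exact: bmeas_sum. Qed.

Let negl_tail (U : T -> R) : measurable_fun setT U ->
  forall eps, 0 < eps -> exists2 A, 0 < A & \int[P]_t tail A (U t) <= eps.
Proof.
move=> mU eps eps0.
have : \forall k \near \oo, \int[P]_t tail k.+1%:R (U t) <= eps.
  exact: (cvgr_le 0 (Rint_tail_cvg P mU)).
by move=> [k _ /(_ k (leqnn k)) h]; exists k.+1%:R.
Qed.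

(** The mean of [clipD_sqr_le] at [X l] and [Y l.+1]; their independence splits the mean of the
    product. *)
Let Rint_clip_step_le l n A : 0 < A ->
  \int[P]_t (clip n%:R (X l t + Y l.+1 t) - clip n%:R (X l t) -
             clip n%:R (Y l.+1 t)) ^+ 2 <=
  4 * A ^+ 2 + 9 * (\int[P]_t tail A (X l t) * w n).
Proof.
move=> A0; pose F (z : R * R * R) := tail A z.1.1 * clip n%:R z.2 ^+ 2.
have bF : bmeas F.
  apply: bmeasM.
    apply: (bmeas_comp (h := fun z : R * R * R => z.1.1)) (bmeas_tail A).
    by apply: measurableT_comp.
  exact: (bmeas_comp measurable_snd (bmeasX (bclip n))).
have bt : bmeas (fun t => tail A (X l t)).
  exact: (bmeas_comp (measurable_partial_sum Y l) (bmeas_tail A)).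
have bFt : bmeas (fun t => F (X l t, X l t, Y l.+1 t)).
  by apply: bmeasM => //; exact: (bmeasX (bclipY _ _)).
have <- : \int[P]_t F (X l t, X l t, Y l.+1 t) = \int[P]_t tail A (X l t) * w n.
  rewrite (Rint_next Y_iid (leqnn l) (leqnn l) bF) /F /=.
  have bc2 := bmeasX (bclip n).
  under eq_Rintegral do rewrite RintZ// -(Rint_iid Y_iid 0 bc2) mulrC.
  by rewrite RintZ// mulrC.
have bc4 : bmeas (fun _ : T => 4 * A ^+ 2) by exact: bmeas_cst.
have b9 : bmeas (fun t => 9 * F (X l t, X l t, Y l.+1 t)).
  by apply: bmeasM => //; exact: bmeas_cst.
have -> : 4 * A ^+ 2 + 9 * \int[P]_t F (X l t, X l t, Y l.+1 t) =
    \int[P]_t (4 * A ^+ 2 + 9 * F (X l t, X l t, Y l.+1 t)).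
  by rewrite RintD// Rint_cst RintZ.
apply: le_Rint; [|exact: bmeasD|].
  apply: bmeasX; apply: bmeasB => //; apply: bmeasB => //.
  apply: (bmeas_comp (h := fun t => X l t + Y l.+1 t)) (bclip n).
  by apply: measurable_funD; [exact: measurable_partial_sum|exact: measurable_funPT].
by move=> t; exact: clipD_sqr_le.
Qed.

(** Induction on [l], adding the error [S] of one more summand and using (u + v)^2 <= 2u^2 + 2v^2.
    The level [A] is chosen first, to make the tail of [X l] small; its square then enters the
    constant. *)
Let negl_Dev l : negl w (fun n => \int[P]_t Dev l n t ^+ 2).
Proof.
elim: l => [|l IHl].
  have -> : (fun n => \int[P]_t Dev 0 n t ^+ 2) = fun=> 0.
    apply/funext => n; rewrite -[RHS](Rint_cst P); apply: eq_Rintegral => t _.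
    by rewrite /Dev big_geq// subr0 /X partial_sum0 clip0// expr0n.
  move=> eps eps0; exists 0 => n; rewrite add0r mulr_ge0 ?(ltW eps0)//.
  by apply: Rintegral_ge0 => t _; exact: sqr_ge0.
pose S n t := clip n%:R (X l t + Y l.+1 t) - clip n%:R (X l t) - clip n%:R (Y l.+1 t).
have bS n : bmeas (S n).
  apply: bmeasB => //; apply: bmeasB => //.
  apply: (bmeas_comp (h := fun t => X l t + Y l.+1 t)) (bclip n).
  by apply: measurable_funD; [exact: measurable_partial_sum|exact: measurable_funPT].
have negl_S : negl w (fun n => \int[P]_t S n t ^+ 2).
  move=> eps eps0.
  have [A A0 tA] := negl_tail (measurable_partial_sum Y l) (divr_gt0 eps0 (ltr0n R 9)).
  exists (4 * A ^+ 2) => n; apply: (le_trans (Rint_clip_step_le l n A0)).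
  rewrite lerD2l mulrA ler_wpM2r//; first by apply: Rintegral_ge0 => t _; exact: sqr_ge0.
  by rewrite mulrC -ler_pdivlMr.
apply: (negl_le _ (neglD (neglZ (ltr0n R 2) IHl) (neglZ (ltr0n R 2) negl_S))) => n.
have bD2 := bmeasX (bDev l n); have bS2 := bmeasX (bS n).
have b2 F : bmeas F -> bmeas (fun t : T => 2 * F t).
  by move=> bF; apply: bmeasM => //; exact: bmeas_cst.
have -> : 2 * \int[P]_t Dev l n t ^+ 2 + 2 * \int[P]_t S n t ^+ 2 =
    \int[P]_t (2 * Dev l n t ^+ 2 + 2 * S n t ^+ 2).
  by rewrite RintD ?RintZ//; exact: b2.
apply: le_Rint; [exact: bmeasX|by apply: bmeasD; exact: b2|move=> t].
have -> : Dev l.+1 n t = Dev l n t + S n t.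
  by rewrite /Dev /S /X partial_sumS big_nat_recr//=; ring.
have := sqr_ge0 (Dev l n t - S n t); nra.
Qed.

(** Splitting at level [A] bounds the truncated mean by [A] plus a tail part, whose square
    Cauchy-Schwarz bounds by a small multiple of [w n]. Hence the truncated variance is equivalent
    to [w n]. *)
Let negl_mean : negl w (fun n => e n ^+ 2).
Proof.
move=> eps eps0.
have [A A0 tA] := negl_tail (measurable_funPT (Y 0%N)) (divr_gt0 eps0 (ltr0n R 2)).
exists (2 * A ^+ 2) => n.
pose tl t := tail A (Y 0%N t).
have btl : bmeas tl by exact: (bmeas_comp (measurable_funPT (Y 0%N)) (bmeas_tail A)).
pose u t := `|clip n%:R (Y 0%N t)|.
have bu : bmeas u.
  split; first by apply: measurableT_comp => //; exact: (bclipY n 0).1.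
  by exists n%:R => t; rewrite normr_id clip_le.
have w0 : 0 <= w n by apply: Rintegral_ge0 => t _; exact: sqr_ge0.
have btu := bmeasM btl bu.
have eA : `|e n| <= A + \int[P]_t (tl t * u t).
  rewrite (le_trans (le_normr_Rintegral _ (bmeas_integrable P (bclipY n 0))))//.
  have -> : A + \int[P]_t (tl t * u t) = \int[P]_t (A + tl t * u t).
    by rewrite RintD ?Rint_cst//; exact: bmeas_cst.
  apply: le_Rint => // [|t]; first by apply: bmeasD => //; exact: bmeas_cst.
  rewrite -/(u t) /tl; have u0 : 0 <= u t := normr_ge0 _.
  have [YA|/ltW AY] := leP `|Y 0%N t| A; last by rewrite tail1// mul1r lerDr ltW.
  have : u t <= `|Y 0%N t| by exact: clip_norm_le.
  have : 0 <= tail A (Y 0%N t) * u t by rewrite mulr_ge0// tail_ge0.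
  lra.
have tu_ge0 : 0 <= \int[P]_t (tl t * u t).
  by apply: Rintegral_ge0 => t _; rewrite mulr_ge0// ?tail_ge0// normr_ge0.
have cs : (\int[P]_t (tl t * u t)) ^+ 2 <= eps / 2 * w n.
  apply: (le_trans (Rint_cauchy_schwarz P btl bu)).
  have -> : \int[P]_t u t ^+ 2 = w n.
    by apply: eq_Rintegral => t _; rewrite real_normK ?num_real.
  rewrite ler_wpM2r// (le_trans _ tA)//; apply: le_Rint => //; first exact: bmeasX.
  by move=> t; rewrite expr2 ler_piMl ?tail_le1// tail_ge0.
have : e n ^+ 2 <= (A + \int[P]_t (tl t * u t)) ^+ 2.
  by rewrite -[leLHS]real_normK ?num_real// ler_sqr ?nnegrE// addr_ge0 ?(ltW A0).
have := sqr_ge0 (A - \int[P]_t (tl t * u t)); nra.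
Qed.

Let h (n : nat) y : R := clip n%:R y - e n.
Let v n := \int[P]_t h n (Y 0%N t) ^+ 2.
Let Z n j t := \sum_(1 <= i < j.+1) h n (Y i t).
Let U n j t := clip n%:R (X j t) - \int[P]_s clip n%:R (X j s).
Let D n j t := U n j t - Z n j t.

Let bh n : bmeas (h n).
Proof. by apply: bmeasB => //; exact: bmeas_cst. Qed.

Let bhY n i : bmeas (fun t => h n (Y i t)).
Proof. exact: (bmeas_comp (measurable_funPT (Y i)) (bh n)). Qed.

Let bZ n j : bmeas (Z n j). Proof. exact: bmeas_sum. Qed.

Let bU n j : bmeas (U n j). Proof. by apply: bmeasB => //; exact: bmeas_cst. Qed.

Let bD n j : bmeas (D n j). Proof. exact: bmeasB. Qed.

Let h_mean0 n : \int[P]_t h n (Y 0%N t) = 0.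
Proof. by rewrite RintB ?Rint_cst ?subrr//; exact: bmeas_cst. Qed.

Let U_mean0 n j : \int[P]_t U n j t = 0.
Proof. by rewrite RintB ?Rint_cst ?subrr//; exact: bmeas_cst. Qed.

Let vE n : v n = w n - e n ^+ 2.
Proof.
transitivity (\int[P]_t (clip n%:R (Y 0%N t) ^+ 2 -
    (2 * e n * clip n%:R (Y 0%N t) - e n ^+ 2))).
  by apply: eq_Rintegral => t _; rewrite /h; ring.
have bZ' (k : R) F : bmeas F -> bmeas (fun t : T => k * F t).
  by move=> bF; apply: bmeasM => //; exact: bmeas_cst.
have be : bmeas (fun _ : T => e n ^+ 2) by exact: bmeas_cst.
have bc2 := bmeasX (bclipY n 0); have bce := bZ' (2 * e n) _ (bclipY n 0).
rewrite RintB// ?RintB// ?Rint_cst ?RintZ//; last exact: bmeasB.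
by rewrite -/(w n) -/(e n); ring.
Qed.

Let ZZ n j k : \int[P]_t (Z n j t * Z n k t) = (minn j k)%:R * v n.
Proof.
exact: (Rint_sum_iidM Y_iid (bh n).1 (sqint_bmeas P (bhY n 0)) (h_mean0 n)).
Qed.

(** [D n j] is [Dev j n] minus its mean, and centring lowers the mean square. *)
Let D_sqr_le n j : \int[P]_t D n j t ^+ 2 <= \int[P]_t Dev j n t ^+ 2.
Proof.
pose c := \int[P]_t Dev j n t.
have DE t : D n j t = Dev j n t - c.
  rewrite /c RintB//; last exact: bmeas_sum.
  rewrite Rint_sum//.
  rewrite (eq_bigr (fun=> e n)) => [|i _]; last first.
    by rewrite (Rint_iid Y_iid i (bclip n)) -(Rint_iid Y_iid 0 (bclip n)).
  by rewrite /D /U /Z sumrB /Dev; ring.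
have -> : \int[P]_t D n j t ^+ 2 = \int[P]_t Dev j n t ^+ 2 - c ^+ 2.
  transitivity (\int[P]_t (Dev j n t ^+ 2 - (2 * c * Dev j n t - c ^+ 2))).
    by apply: eq_Rintegral => t _; rewrite DE; ring.
  have bc : bmeas (fun _ : T => c ^+ 2) by exact: bmeas_cst.
  have bcD : bmeas (fun t => 2 * c * Dev j n t).
    by apply: bmeasM => //; exact: bmeas_cst.
  have bD2 := bmeasX (bDev j n).
  rewrite RintB// ?RintB// ?Rint_cst ?RintZ//; last exact: bmeasB.
  by rewrite -/c; ring.
by rewrite gerBl sqr_ge0.
Qed.

Let w_pos : \forall n \near \oo, 0 < w n.
Proof. exact: (cvgry_gt w_cvg). Qed.

Let v_cvg : v n / w n @[n --> \oo] --> (1 : R).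
Proof.
have e_cvg := negl_cvg0 w_cvg (fun n => sqr_ge0 (e n)) negl_mean.
have : 1 - e n ^+ 2 / w n @[n --> \oo] --> (1 : R).
  rewrite -[X in _ --> X]subr0; apply: cvgB => //; exact: cvg_cst.
apply: cvg_trans; apply: near_eq_cvg; near=> n.
have wn : 0 < w n by near: n.
by rewrite vE mulrBl divff// gt_eqF.
Unshelve. all: by end_near. Qed.

Let D_cvg j : (\int[P]_t D n j t ^+ 2) / w n @[n --> \oo] --> (0 : R).
Proof.
apply: (negl_cvg0 w_cvg) => [n|].
  by apply: Rintegral_ge0 => t _; exact: sqr_ge0.
exact: (negl_le (D_sqr_le ^~ j) (negl_Dev j)).
Qed.

Let product_cvg0 (F G : nat -> T -> R) (l : R) :
  (forall n, bmeas (F n)) -> (forall n, bmeas (G n)) ->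
  (\int[P]_t F n t ^+ 2) / w n @[n --> \oo] --> l ->
  (\int[P]_t G n t ^+ 2) / w n @[n --> \oo] --> (0 : R) ->
  (\int[P]_t (F n t * G n t)) / w n @[n --> \oo] --> (0 : R).
Proof.
move=> bF bG Fl G0; apply: (cvg0_sqr_le _ Fl G0); near=> n.
have wn : 0 < w n by near: n.
have := Rint_cauchy_schwarz P (bF n) (bG n).
rewrite expr_div_n mulrACA -invfM -expr2 => cs.
by rewrite ler_pM2r// invr_gt0 exprn_gt0.
Unshelve. all: by end_near. Qed.

(** Expanding U = Z + D, the product of the [Z] has mean [(minn j k)%:R * v n], and [product_cvg0]
    removes each term containing a [D]. *)
Let UU_cvg j k :
  (\int[P]_t (U n j t * U n k t)) / w n @[n --> \oo] --> ((minn j k)%:R : R).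
Proof.
have Z_cvg i : (\int[P]_t Z n i t ^+ 2) / w n @[n --> \oo] --> (i%:R : R).
  have -> : (fun n => (\int[P]_t Z n i t ^+ 2) / w n) = (fun n => i%:R * (v n / w n)).
    apply/funext => n; under eq_Rintegral do rewrite expr2.
    by rewrite ZZ minnn mulrA.
  by rewrite -[X in _ --> X]mulr1; apply: cvgM => //; exact: cvg_cst.
have ZD_cvg i l := product_cvg0 (bZ ^~ i) (bD ^~ l) (Z_cvg i) (D_cvg l).
have DD_cvg i l := product_cvg0 (bD ^~ i) (bD ^~ l) (D_cvg i) (D_cvg l).
have -> : (fun n => (\int[P]_t (U n j t * U n k t)) / w n) = (fun n =>
    (minn j k)%:R * (v n / w n) + ((\int[P]_t (Z n j t * D n k t)) / w n +
    ((\int[P]_t (Z n k t * D n j t)) / w n +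
     (\int[P]_t (D n j t * D n k t)) / w n))).
  apply/funext => n; rewrite mulrA -!mulrDl; congr (_ / _).
  rewrite -ZZ -!RintD; do ?[apply: bmeasD]; try exact: bmeasM.
  by apply: eq_Rintegral => t _; rewrite /D; ring.
rewrite -[X in _ --> X]addr0; apply: cvgD.
  by rewrite -[X in _ --> X]mulr1; apply: cvgM => //; exact: cvg_cst.
rewrite -[X in _ --> X]addr0; apply: cvgD => //.
by rewrite -[X in _ --> X]addr0; apply: cvgD.
Qed.

Variables (p : nat) (m : 'I_p -> nat).
Hypothesis m_ge1 : forall j, (1 <= m j)%N.

(** The transforms are the clipped variables, centred. They are admissible only for large n, once
    [UU_cvg] makes their variances positive. *)
Lemma clip_transform_overlap : exists f : nat -> 'I_p -> {mfun R >-> R},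
  (\forall n \near \oo, admissible P (fun j => X (m j)) (f n)) /\
  (forall j k, correlation_mx P (transform (fun j => X (m j)) (f n)) j k
     @[n --> \oo] --> overlap_mx R m j k).
Proof.
have mf n j : measurable_fun setT
    (fun x : R => clip n%:R x - \int[P]_s clip n%:R (X (m j) s)).
  by apply: measurable_funB; [exact: measurable_clip|exact: measurable_cst].
pose f n j : {mfun R >-> R} := HB.pack
  (fun x : R => clip n%:R x - \int[P]_s clip n%:R (X (m j) s))
  (isMeasurableFun.Build _ _ _ _ _ (mf n j)).
have fE n j : transform (fun j => X (m j)) (f n) j = U n (m j) by [].
have m0 j : 0 < (m j)%:R :> R by rewrite ltr0n.
exists f; split.
  have U2_gt0 : \forall n \near \oo, forall j, 0 < \int[P]_t U n (m j) t ^+ 2.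
    apply: filter_forall => j.
    have mjj : (0 : R) < (minn (m j) (m j))%:R by rewrite minnn.
    have UU_gt0 := cvgr_gt _ (@UU_cvg (m j) (m j)) 0 mjj; near=> n.
    have wn : 0 < w n by near: n.
    have : 0 < (\int[P]_t (U n (m j) t * U n (m j) t)) / w n.
      by near: n; exact: UU_gt0.
    have -> : \int[P]_t U n (m j) t ^+ 2 = \int[P]_t (U n (m j) t * U n (m j) t).
      by apply: eq_Rintegral => t _; rewrite expr2.
    by rewrite pmulr_lgt0 ?invr_gt0.
  near=> n; apply/(admissibleP Y m) => j; rewrite fE; split=> //.
    exact: sqint_bmeas.
  by have : forall j, 0 < \int[P]_t U n (m j) t ^+ 2 by near: n.
move=> j k; pose c n i l := (\int[P]_t (U n (m i) t * U n (m l) t)) / w n.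
have : c n j k / (Num.sqrt (c n j j) * Num.sqrt (c n k k)) @[n --> \oo] -->
    overlap_mx R m j k.
  have -> : overlap_mx R m j k = (minn (m j) (m k))%:R /
      (Num.sqrt (minn (m j) (m j))%:R * Num.sqrt (minn (m k) (m k))%:R) :> R.
    by rewrite mxE !minnn sqrtrM.
  apply: cvgM; first exact: UU_cvg.
  apply: cvgV; first by rewrite !minnn mulf_neq0// gt_eqF// sqrtr_gt0.
  by apply: cvgM; apply: continuous_cvg (@UU_cvg _ _); exact: sqrt_continuous.
apply: cvg_trans; apply: near_eq_cvg; near=> n.
have wn : 0 < w n by near: n.
rewrite mxE correlationE !fE !rcov_centered//.
(* Dividing all covariances by [w n] leaves the correlation unchanged. *)
apply: div_sqrt_scale => //; apply: Rintegral_ge0 => t _.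
  by rewrite -expr2 sqr_ge0.
by rewrite -expr2 sqr_ge0.
Unshelve. all: by end_near. Qed.

End infinite_second_moment.

(** * Lower bound from a convergent sequence of admissible correlation matrices *)

Section lower_bound.
Context d (T : measurableType d) (R : realType) (P : probability T R).
Variables (p : nat) (X : 'I_p -> T -> R) (C : 'M[R]_p).
Variable f : nat -> 'I_p -> {mfun R >-> R}.
Hypothesis f_admissible : \forall n \near \oo, admissible P X (f n).
Hypothesis f_cvg : forall j k,
  correlation_mx P (transform X (f n)) j k @[n --> \oo] --> C j k.
Variables (nu : set 'I_p -> \bar R) (W : 'M[R]_p).

Lemma weighted_form_cvg V h :
  weighted_form nu V (correlation_mx P (transform X (f n))) h @[n --> \oo] -->
  weighted_form nu V C h.
Proof.
apply: cvg_big => [|j _]; first exact: add_continuous.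
apply: cvg_big => [|k _]; first exact: add_continuous.
do 5 apply: cvgMl; exact: f_cvg.
Qed.

(** For fixed [h] the form is continuous in the correlation matrix, so its value at the limit [C]
    inherits the bound valid along the sequence; the supremum over [h] is taken afterwards. *)
Lemma form_max_le_rhoNL : (form_max nu W C <= rhoNL_max P X nu W)%E.
Proof.
apply: ge_ereal_sup => _ [h h1 <-].
have ub : \forall n \near \oo,
    ((weighted_form nu W (correlation_mx P (transform X (f n))) h)%:E <=
     rhoNL_max P X nu W)%E.
  near=> n; have fn : admissible P X (f n) by near: n.
  apply: (@le_trans _ _ (form_max nu W (correlation_mx P (transform X (f n))))).
    by apply: ereal_sup_ubound; exists h.
  by apply: ereal_sup_ubound; exists (f n).
move: (rhoNL_max P X nu W) ub => [M| |] ub.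
- rewrite lee_fin -(cvg_lim _ (@weighted_form_cvg W h))//; apply: limr_le.
    by apply/cvg_ex; eexists; exact: weighted_form_cvg.
  by apply: filterS ub => n; rewrite lee_fin.
- exact: leey.
- by have [n _ /(_ n (leqnn n))] := ub.
Unshelve. all: by end_near. Qed.

Lemma rhoNL_min_le_form : (rhoNL_min P X nu W <= form_min nu W C)%E.
Proof.
apply: le_ereal_inf_tmp => _ [h h1 <-].
have lb : \forall n \near \oo, (rhoNL_min P X nu W <=
    (weighted_form nu W (correlation_mx P (transform X (f n))) h)%:E)%E.
  near=> n; have fn : admissible P X (f n) by near: n.
  apply: (@le_trans _ _ (form_min nu W (correlation_mx P (transform X (f n))))).
    by apply: ereal_inf_lbound; exists (f n).
  by apply: ereal_inf_lbound; exists h.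
move: (rhoNL_min P X nu W) lb => [M| |] lb.
- rewrite lee_fin -(cvg_lim _ (@weighted_form_cvg W h))//; apply: limr_ge.
    by apply/cvg_ex; eexists; exact: weighted_form_cvg.
  by apply: filterS lb => n; rewrite lee_fin.
- by have [n _ /(_ n (leqnn n))] := lb.
- exact: leNye.
Unshelve. all: by end_near. Qed.

End lower_bound.

(** * Both bounds combined *)

Section main.
Context d (T : measurableType d) (R : realType) (P : probability T R).
Variables (Y : nat -> {RV P >-> R}) (n : nat) (m : 'I_n -> nat).
Hypotheses (Y_iid : iid Y) (Y_nd : non_degenerate (Y 0%N)).
Hypothesis m_ge1 : forall j, (1 <= m j)%N.

Let X (j : 'I_n) : T -> R := partial_sum Y (m j).

Lemma sqint_second_moment : ('E_P[(Y 0%N : T -> R) ^+ 2] < +oo)%E ->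
  sqint P (Y 0%N).
Proof.
rewrite expectation.unlock => h; split; first exact: measurable_funPT.
apply/integrableP; split.
  by apply/measurable_EFinP; exact: measurable_funX (measurable_funPT _).
by under eq_integral do rewrite /= ger0_norm ?sqr_ge0//.
Qed.

(** With a finite second moment a constant sequence of centred linear transforms is exact; otherwise
    clipped transforms converge. *)
Lemma overlap_approximation : exists f : nat -> 'I_n -> {mfun R >-> R},
  (\forall i \near \oo, admissible P X (f i)) /\
  (forall j k, correlation_mx P (transform X (f i)) j k
     @[i --> \oo] --> overlap_mx R m j k).
Proof.
have [|Y2] := ltP ('E_P[(Y 0%N : T -> R) ^+ 2])%E +oo%E.
  move=> /sqint_second_moment sY.
  have [f fa fC] := linear_transform_overlap Y_iid Y_nd m_ge1 sY.
  exists (fun=> f); split; first by near=> i.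
  by move=> j k; rewrite fC; exact: cvg_cst.
apply: clip_transform_overlap => //.
by apply/eqP; rewrite -leye_eq; move: Y2; rewrite expectation.unlock.
Unshelve. all: by end_near. Qed.

Variables (nu : set 'I_n -> \bar R) (W : 'M[R]_n).
Hypothesis nu_ge0 : forall A, (0 <= nu A)%E.
Hypothesis W_sym : forall j k, W j k = W k j.

Lemma rhoNL_maxE : rhoNL_max P X nu W = form_max nu W (overlap_mx R m).
Proof.
have [f [fa fC]] := overlap_approximation.
apply/eqP; rewrite eq_le rhoNL_max_le//=.
exact: form_max_le_rhoNL fa fC nu W.
Qed.

Lemma rhoNL_minE : rhoNL_min P X nu W = form_min nu W (overlap_mx R m).
Proof.
have [f [fa fC]] := overlap_approximation.
apply/eqP; rewrite eq_le rhoNL_min_ge// andbT.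
exact: rhoNL_min_le_form fa fC nu W.
Qed.

End main.

Theorem theorem2 (d : measure_display) (T : measurableType d) (R : realType)
    (P : probability T R) (Y : nat -> {RV P >-> R})
    (n : nat) (m : 'I_n.+1 -> nat)
    (Y_iid : iid Y) (Y_nondegenerate : non_degenerate (Y 0%N))
    (m_ge1 : forall j, (1 <= m j)%N)
    (m_mono : forall j k : 'I_n.+1, (j <= k)%N -> (m j <= m k)%N) :
  let X : 'I_n.+1 -> T -> R := fun j => partial_sum Y (m j) in
  (forall W : 'M[R]_n.+1,
     (forall j k, W j k = W k j) -> (forall j k, 0 <= W j k) ->
     rhoNL_max P X counting W = (lambda_max (schur_prod (overlap_mx R m) W))%:E /\
     rhoNL_min P X counting W = (lambda_min (schur_prod (overlap_mx R m) W))%:E)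
  /\
  (('E_P[(Y 0%N : T -> R) ^+ 2] < +oo)%E ->
     overlap_mx R m = correlation_mx P X /\
     (forall (nu : {finite_measure set 'I_n.+1 -> \bar R}) (W : 'M[R]_n.+1),
        nu [set: 'I_n.+1] <> 0%E ->
        (forall j k, W j k = W k j) -> (forall j k, 0 <= W j k) ->
        rhoNL_max P X nu W = rhoL_max P X nu W /\
        rhoNL_min P X nu W = rhoL_min P X nu W)).
Proof.
move=> X; split=> [W W_sym _|/sqint_second_moment sY].
  have counting_ge0 (A : set 'I_n.+1) : (0 <= counting A :> \bar R)%E.
    exact: measure_ge0.
  have sRW : (schur_prod (overlap_mx R m) W)^T = schur_prod (overlap_mx R m) W.
    by apply/matrixP => j k; rewrite mxE [LHS]mxE [RHS]mxE overlap_mxC W_sym.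
  by rewrite rhoNL_maxE// rhoNL_minE// form_max_counting// form_min_counting.
have XR : correlation_mx P X = overlap_mx R m by exact: correlation_partial_sum.
split=> // nu W _ W_sym _.
have nu_ge0 A : (0 <= nu A)%E by exact: measure_ge0.
(* Since [R] is the correlation matrix of [X], the linear versions are by definition the extrema of
   its form. *)
by rewrite rhoNL_maxE// rhoNL_minE// /rhoL_max /rhoL_min XR.
Qed.
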